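(* The epi-recursors $r_1,\ldots,r_9$ defined in the context compare as follows by quasi-strength: $r_1\simeq r_2\simeq r_3\simeq r_4\simeq r_5\simeq r_6\gtrsim r_8\simeq r_9\gtrsim r_7$.
   Context: **Epi-recursors and quasi-strength.** An epi-recursor is a tuple $r=(\underline{\mathcal B},T,\underline{\mathcal C},I,R)$ where $\underline{\mathcal B}$ is a category (the base category), $T$ is an object of $\underline{\mathcal B}$ (the base object), $\underline{\mathcal C}$ is a category (the extended category), $I$ is an initial object of $\underline{\mathcal C}$, and $R:\underline{\mathcal C}\to\underline{\mathcal B}$ is a functor with $R\,I=T$. Write $!_{I,C}:I\to C$ for the unique morphism. A morphism $g:T\to B$ in $\underline{\mathcal B}$ is definable by $r$ if $g=R\,!_{I,C}$ for some object $C$ of $\underline{\mathcal C}$ with $R\,C=B$. An initial segment of a category $\underline{\mathcal C}$ is a pair $(\underline{\mathcal C}_0,(m(C):o(C)\to C)_{C\in\mathsf{Obj}(\underline{\mathcal C})})$ where $\underline{\mathcal C}_0$ is a full subcategory of $\underline{\mathcal C}$ and, for each object $C$ of $\underline{\mathcal C}$, $o(C)$ is an object of $\underline{\mathcal C}_0$ and $m(C)$ is a morphism in $\underline{\mathcal C}$. For epi-recursors $r,r'$ with the same base category $\underline{\mathcal B}$ and base object $T$, $r'\gtrsim r$ means: there exists an initial segment $(\underline{\mathcal B}_0,(m(B):o(B)\to B)_{B\in\mathsf{Obj}(\underline{\mathcal B})})$ of $\underline{\mathcal B}$ such that for all morphisms $g:T\to B$ definable by $r$ there exists a morphism $g_0:T\to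 o(B)$ definable by $r'$ with $g=m(B)\circ g_0$. $r\simeq r'$ means $r\gtrsim r'$ and $r'\gtrsim r$. **Terms.** $\mathsf{Var}$ is a countably infinite set of variables. $\mathsf{Tr}$ is the set of $\lambda$-terms over $\mathsf{Var}$, i.e. $\alpha$-equivalence classes of the preterms freely generated by the grammar $p::=\mathsf{PVr}\,x\mid\mathsf{PAp}\,p_1\,p_2\mid\mathsf{PLm}\,x\,p$ (where $\mathsf{PLm}\,x\,p$ binds $x$ in $p$), with induced constructors $\mathsf{Vr}:\mathsf{Var}\to\mathsf{Tr}$, $\mathsf{Ap}:\mathsf{Tr}\to\mathsf{Tr}\to\mathsf{Tr}$, $\mathsf{Lm}:\mathsf{Var}\to\mathsf{Tr}\to\mathsf{Tr}$. $\mathsf{Perm}$ is the set of bijections $\sigma:\mathsf{Var}\to\mathsf{Var}$ with $\mathsf{supp}\,\sigma=\{x\mid\sigma\,x\neq x\}$ finite; $\mathsf{id}$ is the identity; $x\leftrightarrow y$ is the transposition of $x$ and $y$. For variables, $x[z_1\wedge z_2]=(z_1\leftrightarrow z_2)(x)$, and $x[y/z]$ is $y$ if $x=z$ and $x$ otherwise. The standard operators on terms are: permutation $t[\sigma]$ (apply $\sigma$ to all variables of $t$, free, bound and binding), swapping $t[x\wedge y]=t[x\leftrightarrow y]$, capture-avoiding substitution $t[s/x]$ of the term $s$ for the variable $x$ in $t$, renaming $t[y/x]=t[(\mathsf{Vr}\,y)/x]$, the free-variable operator $\mathsf{FV}\,t$, and freshness $x\,\#\,t$ iff $x\notin\mathsf{FV}\,t$.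 **Signatures and models.** The symbols are $\mathsf{vr},\mathsf{ap},\mathsf{lm},\mathsf{pm},\mathsf{sw},\mathsf{sb},\mathsf{ren},\mathsf{fv},\mathsf{fr}$; a signature is a set of symbols. $\Sigma_{\mathsf{ctor}}=\{\mathsf{vr},\mathsf{ap},\mathsf{lm}\}$. A $\Sigma$-model $\mathcal M$ consists of a carrier set $M$ and, for each symbol in $\Sigma$, an operation/relation: $\mathsf{vr}$: $\mathsf{Vr}^{\mathcal M}:\mathsf{Var}\to M$; $\mathsf{ap}$: $\mathsf{Ap}^{\mathcal M}:M\to M\to M$; $\mathsf{lm}$: $\mathsf{Lm}^{\mathcal M}:\mathsf{Var}\to M\to M$; $\mathsf{pm}$: $\_[\_]^{\mathcal M}:M\to\mathsf{Perm}\to M$; $\mathsf{sw}$: $\_[\_\wedge\_]^{\mathcal M}:M\to\mathsf{Var}\to\mathsf{Var}\to M$; $\mathsf{sb}$: $\_[\_/\_]^{\mathcal M}:M\to M\to\mathsf{Var}\to M$; $\mathsf{ren}$: $\_[\_/\_]^{\mathcal M}:M\to\mathsf{Var}\to\mathsf{Var}\to M$; $\mathsf{fv}$: $\mathsf{FV}^{\mathcal M}:M\to\mathcal P(\mathsf{Var})$; $\mathsf{fr}$: $\#^{\mathcal M}:\mathsf{Var}\to M\to\mathsf{Bool}$. A morphism $g:\mathcal M\to\mathcal M'$ of $\Sigma$-models is a function $g:M\to M'$ commuting with all the operations for symbols in $\Sigma\cap\{\mathsf{vr},\mathsf{ap},\mathsf{lm},\mathsf{pm},\mathsf{sw},\mathsf{sb},\mathsf{ren}\}$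 (e.g. $g(\mathsf{Lm}^{\mathcal M}x\,m)=\mathsf{Lm}^{\mathcal M'}x\,(g\,m)$, $g(m[n/x]^{\mathcal M})=(g\,m)[(g\,n)/x]^{\mathcal M'}$), and such that $x\,\#^{\mathcal M}\,m$ implies $x\,\#^{\mathcal M'}(g\,m)$ if $\mathsf{fr}\in\Sigma$, and $\mathsf{FV}^{\mathcal M'}(g\,m)\subseteq\mathsf{FV}^{\mathcal M}m$ if $\mathsf{fv}\in\Sigma$. $\mathcal{T}r(\Sigma)$ is the $\Sigma$-model with carrier $\mathsf{Tr}$ and the standard operators on terms. **Properties** (interpreted in a model $\mathcal M$, superscripts omitted; $m,m_1,m_2,n$ range over $M$; $x,x',x_i,y,y_i,z,z_i$ over $\mathsf{Var}$; $\sigma,\tau$ over $\mathsf{Perm}$; all universally quantified unless said otherwise). Swapping: SwVr: $(\mathsf{Vr}\,x)[z_1\wedge z_2]=\mathsf{Vr}(x[z_1\wedge z_2])$. SwAp: $(\mathsf{Ap}\,m_1\,m_2)[z_1\wedge z_2]=\mathsf{Ap}(m_1[z_1\wedge z_2])(m_2[z_1\wedge z_2])$. SwLm: $(\mathsf{Lm}\,x\,m)[z_1\wedge z_2]=\mathsf{Lm}(x[z_1\wedge z_2])(m[z_1\wedge z_2])$. SwId: $m[z\wedge z]=m$. SwIv: $m[x\wedge y][x\wedge y]=m$. SwCp: $m[x\wedge y][z_1\wedge z_2]=(m[z_1\wedge z_2])[(x[z_1\wedge z_2])\wedge(y[z_1\wedge z_2])]$. SwFv: if $x,y\notin\mathsf{FV}\,m$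 then $m[x\wedge y]=m$. SwCg: if $z\notin\{x_1,x_2\}$, $z\,\#\,m_1$, $z\,\#\,m_2$ and $m_1[z\wedge x_1]=m_2[z\wedge x_2]$ then $\mathsf{Lm}\,x_1\,m_1=\mathsf{Lm}\,x_2\,m_2$. SwBvr: if $x'\neq x$ and $x'\,\#\,m$ then $\mathsf{Lm}\,x\,m=\mathsf{Lm}\,x'(m[x'\wedge x])$. Permutation: PmVr: $(\mathsf{Vr}\,x)[\sigma]=\mathsf{Vr}(\sigma\,x)$. PmAp: $(\mathsf{Ap}\,m_1\,m_2)[\sigma]=\mathsf{Ap}(m_1[\sigma])(m_2[\sigma])$. PmLm: $(\mathsf{Lm}\,x\,m)[\sigma]=\mathsf{Lm}(\sigma\,x)(m[\sigma])$. PmId: $m[\mathsf{id}]=m$. PmCp: $m[\sigma][\tau]=m[\tau\circ\sigma]$. PmFv: if $\mathsf{supp}\,\sigma\cap\mathsf{FV}\,m=\emptyset$ then $m[\sigma]=m$. Substitution: SbVr: $(\mathsf{Vr}\,x)[n/z]=$ (if $x=z$ then $n$ else $\mathsf{Vr}\,x$). SbAp: $(\mathsf{Ap}\,m_1\,m_2)[n/z]=\mathsf{Ap}(m_1[n/z])(m_2[n/z])$. SbLm: if $x\neq z$ and $x\,\#\,n$ then $(\mathsf{Lm}\,x\,m)[n/z]=\mathsf{Lm}\,x(m[n/z])$. SbBvr: if $x'\neq x$ and $x'\,\#\,m$ then $\mathsf{Lm}\,x\,m=\mathsf{Lm}\,x'(m[(\mathsf{Vr}\,x')/x])$. Renaming: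 RnVr: $(\mathsf{Vr}\,x)[y/z]=\mathsf{Vr}(x[y/z])$. RnAp: $(\mathsf{Ap}\,m_1\,m_2)[y/z]=\mathsf{Ap}(m_1[y/z])(m_2[y/z])$. RnLm$_1$: if $x\notin\{y,z\}$ then $(\mathsf{Lm}\,x\,m)[y/z]=\mathsf{Lm}\,x(m[y/z])$. RnLm$_2$: $(\mathsf{Lm}\,x\,m)[z/x]=\mathsf{Lm}\,x\,m$. RnBvr: if $x'\neq x$ and $x'\,\#\,m$ then $\mathsf{Lm}\,x\,m=\mathsf{Lm}\,x'(m[x'/x])$. RnBvr$_2$: if $y\neq x'$ then $\mathsf{Lm}\,x(m[y/x'])=\mathsf{Lm}\,x'(m[y/x'][x'/x])$. RnId: $m[z/z]=m$. RnIm: if $x_1\neq y$ then $m[x_1/y][x_2/y]=m[x_1/y]$. RnCh: if $y\neq x_2$ then $m[y/x_2][x_2/x_1][x_3/x_2]=m[y/x_2][x_3/x_1]$. RnCm: if $x_2\neq y_1\neq x_1\neq y_2$ then $m[x_2/x_1][y_2/y_1]=m[y_2/y_1][x_2/x_1]$. Freshness/freeness: FrVr: if $z\neq x$ then $z\,\#\,\mathsf{Vr}\,x$. FrAp: if $z\,\#\,m_1$ and $z\,\#\,m_2$ then $z\,\#\,\mathsf{Ap}\,m_1\,m_2$. FrLm: if $z=x$ or $z\,\#\,m$ then $z\,\#\,\mathsf{Lm}\,x\,m$. FvVr: $\mathsf{FV}(\mathsf{Vr}\,x)\subseteq\{x\}$. FvAp: $\mathsf{FV}(\mathsf{Ap}\,m_1\,m_2)\subseteq\mathsf{FV}\,m_1\cup\mathsf{FV}\,m_2$.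 FvLm: $\mathsf{FV}(\mathsf{Lm}\,x\,m)\subseteq\mathsf{FV}\,m\setminus\{x\}$. FvDPm: $\mathsf{FV}\,m=\{x\mid\{y\mid m[x\leftrightarrow y]\neq m\}\text{ is infinite}\}$. FvDSw: $\mathsf{FV}\,m=\{x\mid\{y\mid m[x\wedge y]\neq m\}\text{ is infinite}\}$. FCB: there exists $x\in\mathsf{Var}$ such that $x\notin\mathsf{FV}(\mathsf{Lm}\,x\,m)$ for all $m\in M$. A $(\Sigma,\mathsf{Props})$-model is a $\Sigma$-model satisfying all properties in $\mathsf{Props}$. **The sets $\mathsf{Props}_i$.** $\mathsf{Props}_1$ (perm/free): PmVr, PmAp, PmLm, PmId, PmCp, FvDPm, FCB. $\mathsf{Props}_2$ (perm/free variant): PmVr, PmAp, PmLm, PmId, PmCp, PmFv, FvVr, FvAp, FvLm. $\mathsf{Props}_3$ (swap/free variant): SwVr, SwAp, SwLm, SwId, SwIv, SwCp, FvDSw, FCB. $\mathsf{Props}_4$ (swap/free): SwVr, SwAp, SwLm, SwFv, FvVr, FvAp, FvLm. $\mathsf{Props}_5$ (swap/fresh variant): SwVr, SwAp, SwLm, SwBvr, FrVr, FrAp, FrLm. $\mathsf{Props}_6$ (swap/fresh): SwVr, SwAp, SwLm, SwCg, FrVr, FrAp, FrLm. $\mathsf{Props}_7$ (subst/fresh): SbVr, SbAp, SbLm, SbBvr, FrVr, FrAp, FrLm. $\mathsf{Props}_8$ (renaming): RnVr, RnAp, RnLm$_1$, RnLm$_2$, RnBvr$_2$, RnId, RnIm,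 RnCh, RnCm. $\mathsf{Props}_9$ (renaming/fresh variant): RnVr, RnAp, RnLm$_1$, RnBvr, FrVr, FrAp, FrLm. **The epi-recursors.** For $i\in\{1,\ldots,9\}$, $r_i=(\underline{\mathcal B},T,\underline{\mathcal C}_i,I_i,R_i)$, where $\Sigma_i$ consists of all symbols occurring in $\mathsf{Props}_i$, $\underline{\mathcal B}$ is the category of $\Sigma_{\mathsf{ctor}}$-models, $T=\mathcal{T}r(\Sigma_{\mathsf{ctor}})$, $\underline{\mathcal C}_i$ is the category of $(\Sigma_i,\mathsf{Props}_i)$-models and $\Sigma_i$-model morphisms, $I_i=\mathcal{T}r(\Sigma_i)$ (which is initial in $\underline{\mathcal C}_i$), and $R_i:\underline{\mathcal C}_i\to\underline{\mathcal B}$ is the forgetful functor to underlying $\Sigma_{\mathsf{ctor}}$-models. *)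

(* Defs.v *)
From HB Require Import structures.
From mathcomp Require Import all_boot generic_quotient.
From mathcomp Require Import boolp classical_sets cardinality.
From Stdlib Require List.

Set Implicit Arguments.
Unset Strict Implicit.
Unset Printing Implicit Defensive.

Local Open Scope quotient_scope.
Local Open Scope classical_set_scope.

HB.mixin Record isInfinite V of Countable V := {
  infinite_setT : infinite_set [set: V]
}.

#[short(type="varType")]
HB.structure Definition Var := { V of isInfinite V & Countable V }.

HB.instance Definition _ := isInfinite.Build nat infinite_nat.

Section Preterms.
Variable V : varType.
Implicit Types (x y z u v w : V) (s : seq V).

Lemma fresh_exists s : exists x, x \notin s.
Proof.
have [//|/forallNP ns] := pselect (exists x, x \notin s); exfalso; apply: (@infinite_setT V).
apply/finite_seqP; exists s; apply/seteqP; split=> // x _ /=.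
by apply/negPn/negP; exact: ns.
Qed.

Definition fresh s : V := xchoose (fresh_exists s).

Lemma freshP s : fresh s \notin s.
Proof. exact: (xchooseP (fresh_exists s)). Qed.

(* x[z1 /\ z2] *)
Definition swapv z1 z2 x : V :=
  if x == z1 then z2 else if x == z2 then z1 else x.

(* x[y / z] *)
Definition renv y z x : V := if x == z then y else x.

Definition supp (f : V -> V) : set V := [set x | f x <> x].

Record perm := Perm {
  perm_fun :> V -> V;
  perm_bij : bijective perm_fun;
  perm_supp : finite_set (supp perm_fun)
}.

Lemma swapvK z1 z2 : involutive (swapv z1 z2).
Proof.
move=> x; rewrite /swapv; case: (eqVneq x z1) => [->|xz1].
  by rewrite eqxx; case: eqVneq.
case: (eqVneq x z2) => [->|xz2]; first by rewrite eqxx.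
by rewrite (negbTE xz1) (negbTE xz2).
Qed.

Lemma swapv_inj z1 z2 : injective (swapv z1 z2).
Proof. exact: can_inj (swapvK z1 z2). Qed.

Lemma swapvL z1 z2 : swapv z1 z2 z1 = z2.
Proof. by rewrite /swapv eqxx. Qed.

Lemma swapvR z1 z2 : swapv z1 z2 z2 = z1.
Proof. by rewrite /swapv eqxx; case: eqVneq. Qed.

Lemma swapvN z1 z2 x : x != z1 -> x != z2 -> swapv z1 z2 x = x.
Proof. by rewrite /swapv => /negbTE -> /negbTE ->. Qed.

Lemma swapvv z : swapv z z = id.
Proof. by apply/funext => x; rewrite /swapv; case: eqVneq => [->|]. Qed.

Lemma swapv_conj (f : V -> V) z1 z2 x : injective f ->
  f (swapv z1 z2 x) = swapv (f z1) (f z2) (f x).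
Proof.
move=> fI; rewrite /swapv !(inj_eq fI).
by case: eqVneq => // _; case: eqVneq.
Qed.

Lemma swapv_bij z1 z2 : bijective (swapv z1 z2).
Proof. by exists (swapv z1 z2); exact: swapvK. Qed.

Lemma swapv_supp z1 z2 : finite_set (supp (swapv z1 z2)).
Proof.
apply: (@sub_finite_set _ _ [set` [:: z1; z2]]); last exact: finite_seq.
move=> x; rewrite /supp/= !inE => sx; apply/norP => -[n1 n2].
by apply: sx; rewrite swapvN.
Qed.

Definition transp z1 z2 : perm := Perm (swapv_bij z1 z2) (swapv_supp z1 z2).

Lemma permI (p : perm) : injective p.
Proof. exact: bij_inj (perm_bij p). Qed.

Lemma perm_ext (p q : perm) : p =1 q -> p = q.
Proof.
case: p q => [f fb fs] [g gb gs] /= fg.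
have e : f = g by exact/funext.
by subst g; rewrite (Prop_irrelevance fb gb) (Prop_irrelevance fs gs).
Qed.

Lemma id_bij : bijective (@id V). Proof. by exists id. Qed.

Lemma id_supp : finite_set (supp (@id V)).
Proof. by rewrite (_ : supp _ = set0)//; apply/seteqP; split. Qed.

Definition perm_id : perm := Perm id_bij id_supp.

Lemma comp_supp (p q : perm) : finite_set (supp (p \o q)).
Proof.
apply: (@sub_finite_set _ _ (supp p `|` supp q)).
  move=> x; rewrite /supp/= => pqx.
  by case: (pselect (q x = x)) => qx; [left; rewrite qx in pqx|right].
by rewrite finite_setU; split; exact: perm_supp.
Qed.

(* First q, then p. *)
Definition perm_comp (p q : perm) : perm :=
  Perm (bij_comp (perm_bij p) (perm_bij q)) (comp_supp p q).

Inductive preterm := PVr (x : V) | PAp (p q : preterm) | PLm (x : V) (p : preterm).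

Implicit Types (p q r : preterm) (f g : V -> V).

Fixpoint pvars p : seq V :=
  match p with
  | PVr x => [:: x]
  | PAp p q => pvars p ++ pvars q
  | PLm x p => x :: pvars p
  end.

Fixpoint pfv p : seq V :=
  match p with
  | PVr x => [:: x]
  | PAp p q => pfv p ++ pfv q
  | PLm x p => [seq y <- pfv p | y != x]
  end.

(* f is applied to all variables: free, bound and binding. *)
Fixpoint pact f p : preterm :=
  match p with
  | PVr x => PVr (f x)
  | PAp p q => PAp (pact f p) (pact f q)
  | PLm x p => PLm (f x) (pact f p)
  end.

(* In alpha_Lm, z occurs nowhere in either abstraction, free, bound or binding. *)
Inductive alpha : preterm -> preterm -> Prop :=
| alpha_Vr x : alpha (PVr x) (PVr x)
| alpha_Ap p p' q q' : alpha p p' -> alpha q q' -> alpha (PAp p q) (PAp p' q')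
| alpha_Lm x p x' p' z :
    z \notin x :: x' :: pvars p ++ pvars p' ->
    alpha (pact (swapv z x) p) (pact (swapv z x') p') ->
    alpha (PLm x p) (PLm x' p').

Lemma pact_comp f g p : pact f (pact g p) = pact (f \o g) p.
Proof. by elim: p => [x|p IHp q IHq|x p IHp] /=; congruence. Qed.

Lemma pact_id p : pact id p = p.
Proof. by elim: p => [x|p IHp q IHq|x p IHp] /=; congruence. Qed.

Lemma eq_in_pact f g p : {in pvars p, f =1 g} -> pact f p = pact g p.
Proof.
elim: p => [x|p IHp q IHq|x p IHp] /= fg.
- by rewrite fg ?mem_head.
- by rewrite IHp ?IHq// => y yp; apply: fg; rewrite mem_cat yp ?orbT.
- by rewrite IHp ?fg ?mem_head// => y yp; apply: fg; rewrite inE yp orbT.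
Qed.

Lemma pvars_pact f p : pvars (pact f p) = map f (pvars p).
Proof. by elim: p => [x|p IHp q IHq|x p IHp] //=; rewrite ?map_cat ?IHp ?IHq. Qed.

Lemma pfv_pact f p : injective f -> pfv (pact f p) = map f (pfv p).
Proof.
move=> fI; elim: p => [x|p IHp q IHq|x p IHp] //=; first by rewrite map_cat IHp IHq.
rewrite IHp; elim: (pfv p) => //= y s IHs.
by rewrite (inj_eq fI); case: eqVneq => /=; rewrite IHs.
Qed.

Lemma pfv_pvars p : {subset pfv p <= pvars p}.
Proof.
elim: p => [x|p IHp q IHq|x p IHp] //= y.
  by rewrite !mem_cat => /orP[/IHp|/IHq] ->; rewrite ?orbT.
by rewrite mem_filter inE => /andP[_ /IHp] ->; rewrite orbT.
Qed.

Lemma alpha_agree p f g : injective f -> injective g ->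
  {in pfv p, f =1 g} -> alpha (pact f p) (pact g p).
Proof.
elim: p f g => [x|p IHp q IHq|x p IHp] f g fI gI /= fg.
- by rewrite fg ?mem_head//; constructor.
- constructor; [apply: IHp|apply: IHq] => // y yp;
    by apply: fg; rewrite mem_cat yp ?orbT.
- pose z := fresh (f x :: g x :: pvars (pact f p) ++ pvars (pact g p)).
  have /[dup] zP := freshP (f x :: g x :: pvars (pact f p) ++ pvars (pact g p)).
  rewrite -/z !inE !mem_cat !negb_or !pvars_pact => /and4P[zf zg zfp zgp].
  apply: (alpha_Lm zP); rewrite !pact_comp.
  apply: IHp; do ?by apply: inj_comp => //; exact: swapv_inj.
  move=> y yp /=; have [->|yx] := eqVneq y x; first by rewrite !swapvR.
  have zfy: f y != z by apply: contraNneq zfp => <-; apply/map_f/pfv_pvars.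
  have zgy: g y != z by apply: contraNneq zgp => <-; apply/map_f/pfv_pvars.
  rewrite !swapvN ?(inj_eq fI) ?(inj_eq gI)//.
  by apply: fg; rewrite mem_filter yx.
Qed.

Lemma alpha_refl p : alpha p p.
Proof. by rewrite -{1 2}[p]pact_id; apply: alpha_agree. Qed.

Lemma alpha_sym p q : alpha p q -> alpha q p.
Proof.
elim=> [x|p1 p2 q1 q2 _ ? _ ?|x p1 y p2 z zP _ IH]; try by constructor.
apply: alpha_Lm IH; move: zP; rewrite !inE !mem_cat !negb_or.
by move=> /and4P[-> -> -> ->].
Qed.

Lemma pact_swap_conj f z x p : injective f ->
  pact f (pact (swapv z x) p) = pact (swapv (f z) (f x)) (pact f p).
Proof. by move=> fI; rewrite !pact_comp; congr pact; apply/funext => y /=; exact: swapv_conj. Qed.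

Lemma alpha_pact f p q : injective f -> alpha p q -> alpha (pact f p) (pact f q).
Proof.
move=> fI; elim=> [x|p1 p2 q1 q2 _ ? _ ?|x p1 y p2 z zP _ IH] /=; try by constructor.
apply: (@alpha_Lm _ _ _ _ (f z)); last by rewrite -!pact_swap_conj.
by move: zP; rewrite !pvars_pact -map_cat -!map_cons (mem_map fI).
Qed.

Lemma pact_swap2 z u x p : u \notin x :: pvars p -> z \notin x :: pvars p ->
  pact (swapv u z) (pact (swapv z x) p) = pact (swapv u x) p.
Proof.
rewrite !inE !negb_or => /andP[ux up] /andP[zx zp].
rewrite pact_comp; apply: eq_in_pact => y yp /=.
have yu : y != u by apply: contraNneq up => <-.
have yz : y != z by apply: contraNneq zp => <-.
have [->|yx] := eqVneq y x; first by rewrite !swapvR.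
by rewrite !swapvN.
Qed.

Lemma alpha_Lm_any x p y q z :
  alpha (PLm x p) (PLm y q) -> z \notin x :: y :: pvars p ++ pvars q ->
  alpha (pact (swapv z x) p) (pact (swapv z y) q).
Proof.
move=> apq zP; inversion apq as [| |? ? ? ? u uP au]; subst.
move: uP zP; rewrite !inE !mem_cat !negb_or => /and4P[ux uy up uq] /and4P[zx zy zp zq].
have := alpha_pact (@swapv_inj z u) au.
by rewrite !pact_swap2// !inE negb_or ?zx ?zy ?ux ?uy.
Qed.

Lemma alpha_trans p q r : alpha p q -> alpha q r -> alpha p r.
Proof.
move=> pq; suff H f : injective f -> forall r, alpha (pact f q) r -> alpha (pact f p) r.
  by move: (H id (fun x y => id) r); rewrite !pact_id.
elim: {r} pq f => {p q} [x|p p' q q' _ IHp _ IHq|x p y q z zP _ IH] f fI r //= fr.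
  inversion fr; subst; constructor; [exact: IHp|exact: IHq].
inversion fr as [| |? ? w r' ? ? ?]; subst.
set s := f x :: f y :: f z :: w :: pvars (pact f p) ++ pvars (pact f q) ++ pvars r'.
have : fresh s \notin s := freshP s.
move: (fresh s) => u; rewrite /s {s} !inE !mem_cat !negb_or.
move=> /and5P[ux uy uz uw /and3P[up uq ur]].
move: zP; rewrite !inE !mem_cat !negb_or => /and4P[zx zy zp zq].
have := alpha_Lm_any fr (z := u); rewrite !inE !mem_cat !negb_or uy uw uq ur => /(_ isT).
pose h := swapv u (f z) \o f.
have hI : injective h by apply: inj_comp => //; exact: swapv_inj.
have hE t a : z != a -> z \notin pvars t -> u != f a -> u \notin pvars (pact f t) ->
    pact h (pact (swapv z a) t) = pact (swapv u (f a)) (pact f t).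
  move=> za zt ua ut; rewrite /h -(pact_comp (swapv u (f z)) f) pact_swap_conj//.
  rewrite pact_swap2//.
    by rewrite inE negb_or ua.
  by rewrite inE negb_or (inj_eq fI) za pvars_pact (mem_map fI).
rewrite -hE// => /(IH h hI); rewrite hE// => pr.
by apply: alpha_Lm pr; rewrite !inE !mem_cat !negb_or ux uw up.
Qed.

Lemma alpha_fv p q : alpha p q -> pfv p =i pfv q.
Proof.
elim=> [x|p1 p2 q1 q2 _ IH1 _ IH2|x p1 y p2 z zP _ IH] a //=.
  by rewrite !mem_cat IH1 IH2.
move: zP; rewrite !inE !mem_cat !negb_or => /and4P[zx zy zp zq].
have fvE t b : z \notin pvars t ->
    (a \in [seq c <- pfv t | c != b]) = [&& a != b, a != z & a \in pfv (pact (swapv z b) t)].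
  move=> zt; rewrite mem_filter; case: eqVneq => //= ab.
  rewrite pfv_pact; last exact: swapv_inj.
  have [->|az] /= := eqVneq a z.
    by apply: contraNF zt => /pfv_pvars.
  by rewrite -{2}(@swapvN z b a)// mem_map//; exact: swapv_inj.
rewrite !fvE// IH.
have zqf : z \notin pfv p2 by apply: contraNN zq; exact: pfv_pvars.
have zpf : z \notin pfv p1 by apply: contraNN zp; exact: pfv_pvars.
have [->|az] /= := eqVneq a z; first by rewrite !andbF.
have aux t b : z \notin pfv t -> a \in pfv (pact (swapv z b) t) -> a != b.
  rewrite pfv_pact; last exact: swapv_inj.
  by move=> zt /mapP[c ct ->]; apply: contraNneq zt => e; rewrite (_ : z = c)//; apply: (@swapv_inj z b); rewrite e swapvL.
have [a2|] /= := boolP (a \in pfv (pact (swapv z y) p2)); last by rewrite !andbF.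
by rewrite (aux _ _ zqf a2) (aux p1 x zpf)// IH.
Qed.

End Preterms.

Arguments PVr {V}.

Section Quotient.
Variable V : varType.
Implicit Types (x y z u v w : V) (s : seq V).
Implicit Types (p q r : preterm V) (f g : V -> V).
Local Notation preterm := (preterm V).
Implicit Types (e : V -> preterm).

Definition upd e x p : V -> preterm := fun y => if y == x then p else e y.

(* Simultaneous capture-avoiding substitution of e y for each free y: every
   binder x is renamed to a z that is not free in e y for any y free in
   PLm x p, so that the recursion is structural. *)
Fixpoint psub e p : preterm :=
  match p with
  | PVr x => e x
  | PAp p q => PAp (psub e p) (psub e q)
  | PLm x p =>
      let z := fresh (flatten [seq pfv (e y) | y <- pfv (PLm x p)]) in
      PLm z (psub (upd e x (PVr z)) p)
  end.

Lemma flatten_fv e (s : seq V) z :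
  z \notin flatten [seq pfv (e y) | y <- s] ->
  forall y, y \in s -> z \notin pfv (e y).
Proof.
move=> zs y ys; apply: contraNN zs => zy.
by apply/flattenP; exists (pfv (e y)) => //; apply: map_f.
Qed.

Lemma pact_fresh f p : injective f -> {in pfv p, f =1 id} -> alpha (pact f p) p.
Proof. by move=> fI fE; rewrite -{2}[p]pact_id; apply: alpha_agree. Qed.

Lemma pact_swap_fresh z z' p : z \notin pfv p -> z' \notin pfv p ->
  alpha (pact (swapv z z') p) p.
Proof.
move=> zp z'p; apply: pact_fresh; first exact: swapv_inj.
by move=> y yp; rewrite swapvN//; apply: contraTneq yp => ->.
Qed.

Lemma psub_act p f e e' : injective f ->
  (forall u, u \in pfv p -> alpha (pact f (e u)) (e' u)) ->
  alpha (pact f (psub e p)) (psub e' p).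
Proof.
elim: p f e e' => [x|p IHp q IHq|x p IHp] f e e' fI /= ee'.
- by apply: ee'; rewrite mem_head.
- constructor; [apply: IHp|apply: IHq] => // u up;
    by apply: ee'; rewrite mem_cat up ?orbT.
have ee u : u \in pfv p -> u != x -> alpha (pact f (e u)) (e' u).
  by move=> up ux; apply: ee'; rewrite mem_filter ux.
set se := flatten _; set se' := flatten _.
have zP u : u \in pfv p -> u != x -> fresh se \notin pfv (e u).
  move=> up ux; have := freshP se; rewrite {2}/se => /flatten_fv; apply.
  by rewrite mem_filter ux.
have zP' u : u \in pfv p -> u != x -> fresh se' \notin pfv (e' u).
  move=> up ux; have := freshP se'; rewrite {2}/se' => /flatten_fv; apply.
  by rewrite mem_filter ux.
move: (fresh se) (fresh se') zP zP' => z z' zP zP' {se se'}.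
set A := psub _ p; set B := psub _ p.
pose sw := [:: f z, z' & pvars (pact f A) ++ pvars B] ++
  flatten [seq pfv (e' y) | y <- pfv p].
have : fresh sw \notin sw := freshP sw.
move: (fresh sw) => w; rewrite /sw {sw} mem_cat negb_or => /andP[wP wQ].
apply: (alpha_Lm wP).
have we u : u \in pfv p -> w \notin pfv (e' u) by exact: (flatten_fv wQ).
apply: (@alpha_trans _ _ (psub (upd e' x (PVr w)) p)).
  rewrite pact_comp; apply: IHp.
    by apply: inj_comp => //; exact: swapv_inj.
  move=> u up; rewrite /upd; case: eqVneq => [_|ux] /=.
    by rewrite swapvR; constructor.
  rewrite -(pact_comp _ f).
  apply: (@alpha_trans _ _ (pact (swapv w (f z)) (e' u))).
    by apply: alpha_pact; [exact: swapv_inj|exact: ee].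
  apply: pact_swap_fresh; first exact: we.
  rewrite -(alpha_fv (ee _ up ux)) pfv_pact// mem_map//; exact: zP.
apply: alpha_sym; apply: IHp; first exact: swapv_inj.
move=> u up; rewrite /upd; case: eqVneq => [_|ux] /=.
  by rewrite swapvR; constructor.
by apply: pact_swap_fresh; [exact: we|exact: zP'].
Qed.

Lemma psub_ext p e e' : (forall u, u \in pfv p -> alpha (e u) (e' u)) ->
  alpha (psub e p) (psub e' p).
Proof.
move=> ee'; rewrite -[psub e p]pact_id; apply: psub_act => // u up.
by rewrite pact_id; exact: ee'.
Qed.

Lemma psub_Lm_any e x p z :
  (forall u, u \in pfv p -> u != x -> z \notin pfv (e u)) ->
  alpha (psub e (PLm x p)) (PLm z (psub (upd e x (PVr z)) p)).
Proof.
move=> zP /=; set se := flatten _.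
have zP' u : u \in pfv p -> u != x -> fresh se \notin pfv (e u).
  move=> up ux; have := freshP se; rewrite {2}/se => /flatten_fv; apply.
  by rewrite mem_filter ux.
move: (fresh se) zP' => z' zP' {se}.
set A := psub _ p; set B := psub _ p.
pose sw := [:: z', z & pvars A ++ pvars B] ++
  flatten [seq pfv (e y) | y <- pfv p].
have : fresh sw \notin sw := freshP sw.
move: (fresh sw) => w; rewrite /sw {sw} mem_cat negb_or => /andP[wP wQ].
apply: (alpha_Lm wP).
have we u : u \in pfv p -> w \notin pfv (e u) by exact: (flatten_fv wQ).
have aux c : (forall u, u \in pfv p -> u != x -> c \notin pfv (e u)) ->
    alpha (pact (swapv w c) (psub (upd e x (PVr c)) p)) (psub (upd e x (PVr w)) p).
  move=> cP; apply: psub_act; first exact: swapv_inj.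
  move=> u up; rewrite /upd; case: eqVneq => [_|ux] /=.
    by rewrite swapvR; constructor.
  by apply: pact_swap_fresh; [exact: we|exact: cP].
by apply: (alpha_trans (aux _ zP')); apply: alpha_sym; exact: aux.
Qed.

Lemma alpha_cLm x p q : alpha p q -> alpha (PLm x p) (PLm x q).
Proof.
move=> pq; have zP := freshP [:: x, x & pvars p ++ pvars q].
by apply: (alpha_Lm zP); apply: alpha_pact => //; exact: swapv_inj.
Qed.

Lemma psub_pact p f e : injective f -> alpha (psub e (pact f p)) (psub (e \o f) p).
Proof.
move=> fI; elim: p e => [x|p IHp q IHq|x p IHp] e.
- exact: alpha_refl.
- by constructor.
rewrite [pact _ _]/=.
pose sw := flatten [seq pfv (e y) | y <- pfv (pact f p)].
have : fresh sw \notin sw := freshP sw.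
move: (fresh sw) => z; rewrite /sw {sw} => /flatten_fv zP.
apply: (@alpha_trans _ _ (PLm z (psub (upd e (f x) (PVr z)) (pact f p)))).
  by apply: psub_Lm_any => u up _; exact: zP.
apply: (@alpha_trans _ _ (PLm z (psub (upd (e \o f) x (PVr z)) p))).
  apply: alpha_cLm; apply: (alpha_trans (IHp _)).
  apply: psub_ext => u _; rewrite /upd /= (inj_eq fI); exact: alpha_refl.
apply/alpha_sym/psub_Lm_any => u up ux.
by apply: zP; rewrite pfv_pact// mem_map.
Qed.

Lemma alpha_psub p q e e' : alpha p q ->
  (forall u, u \in pfv p -> alpha (e u) (e' u)) -> alpha (psub e p) (psub e' q).
Proof.
move=> pq; elim: pq e e' => {p q} [x|p p' q q' _ IHp _ IHq|x p y q z zP pq IH] e e' ee'.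
- by apply: ee'; rewrite mem_head.
- by constructor; [apply: IHp|apply: IHq] => // u up; apply: ee'; rewrite mem_cat up ?orbT.
have pqfv := alpha_fv (alpha_Lm zP pq).
pose sw := flatten [seq pfv (e u) | u <- pfv p] ++ flatten [seq pfv (e' u) | u <- pfv q].
have : fresh sw \notin sw := freshP sw.
move: (fresh sw) => w; rewrite /sw {sw} mem_cat negb_or => /andP[/flatten_fv wp /flatten_fv wq].
apply: (@alpha_trans _ _ (PLm w (psub (upd e x (PVr w)) p))).
  by apply: psub_Lm_any => u up _; exact: wp.
apply: (@alpha_trans _ _ (PLm w (psub (upd e' y (PVr w)) q))); last first.
  by apply/alpha_sym/psub_Lm_any => u up _; exact: wq.
apply: alpha_cLm.
move: zP; rewrite !inE !mem_cat !negb_or => /and4P[zx zy zp zq].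
have aux a t c : z \notin pvars t ->
    alpha (psub (upd c z (PVr w)) (pact (swapv z a) t)) (psub (upd c a (PVr w)) t).
  move=> zt; apply: (alpha_trans (psub_pact _ _ _)); first exact: swapv_inj.
  apply: psub_ext => u ut; rewrite /upd /=.
  have uz : u != z by apply: contraTneq ut => ->; apply: contraNN zt; exact: pfv_pvars.
  have [->|ua] := eqVneq u a; first by rewrite swapvR eqxx; constructor.
  by rewrite swapvN// (negbTE uz); exact: alpha_refl.
apply: (alpha_trans (alpha_sym (aux x p e zp))).
apply: (alpha_trans _ (aux y q e' zq)).
apply: IH => u; rewrite pfv_pact; last exact: swapv_inj.
move=> /mapP[u' u'p ->{u}]; rewrite /upd; case: eqVneq => [_|sz]; first exact: alpha_refl.
have u'x : u' != x by apply: contraNneq sz => ->; rewrite swapvR.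
have u'z : u' != z by apply: contraTneq u'p => ->; apply: contraNN zp; exact: pfv_pvars.
by rewrite swapvN//; apply: ee'; rewrite /= mem_filter u'x.
Qed.

Lemma alpha_Lm_swap x y p : y \notin pfv p -> alpha (PLm x p) (PLm y (pact (swapv y x) p)).
Proof.
move=> yp; have := freshP [:: x, y & pvars p ++ pvars (pact (swapv y x) p)].
move: (fresh _) => z zP; apply: (alpha_Lm zP).
move: zP; rewrite !inE !mem_cat !negb_or => /and4P[zx zy zp zq].
rewrite pact_comp; apply: alpha_agree; first exact: swapv_inj.
  by apply: inj_comp; exact: swapv_inj.
move=> a ap /=.
have az : a != z by apply: contraTneq ap => ->; apply: contraNN zp; exact: pfv_pvars.
have ay : a != y by apply: contraTneq ap => ->.
have [->|ax] := eqVneq a x; first by rewrite !swapvR.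
by rewrite !swapvN// swapvN.
Qed.

HB.instance Definition _ := gen_eqMixin preterm.
HB.instance Definition _ := gen_choiceMixin preterm.

Definition alphab : rel preterm := fun p q => `[< alpha p q >].

Lemma alphab_refl : reflexive alphab.
Proof. by move=> p; apply/asboolP; exact: alpha_refl. Qed.

Lemma alphab_sym : symmetric alphab.
Proof. by move=> p q; apply/asboolP/asboolP; exact: alpha_sym. Qed.

Lemma alphab_trans : transitive alphab.
Proof. by move=> q p r /asboolP pq /asboolP qr; apply/asboolP; exact: alpha_trans qr. Qed.

Canonical alphab_equiv := EquivRel alphab alphab_refl alphab_sym alphab_trans.

Definition Tr := {eq_quot alphab}.

HB.instance Definition _ := EqQuotient.on Tr.

End Quotient.

Section Terms.
Variable V : varType.
Implicit Types (x y z u v w : V) (s : seq V).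
Implicit Types (p q r : preterm V) (f g : V -> V).
Local Notation preterm := (preterm V).
Local Notation Tr := (Tr V).
Implicit Types (t n : Tr) (sg : perm V).

Definition cls p : Tr := \pi_Tr p.

Lemma clsP p q : cls p = cls q <-> alpha p q.
Proof. by split=> [/eqmodP/asboolP|pq]; last exact/eqmodP/asboolP. Qed.

Lemma clsK t : cls (repr t) = t.
Proof. exact: reprK. Qed.

Lemma cls_ind (P : Tr -> Prop) : (forall p, P (cls p)) -> forall t, P t.
Proof. by move=> Pp t; rewrite -[t]clsK. Qed.

Lemma repr_cls p : alpha (repr (cls p)) p.
Proof. by apply/clsP; rewrite clsK. Qed.

Definition Vr x : Tr := \pi_Tr (PVr x).
Definition Ap t1 t2 : Tr := \pi_Tr (PAp (repr t1) (repr t2)).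
Definition Lm x t : Tr := \pi_Tr (PLm x (repr t)).
Definition Perm_tm t sg : Tr := \pi_Tr (pact sg (repr t)).
Definition Swap_tm t x y : Tr := Perm_tm t (transp x y).
(* Subst_tm t n x is t[n / x], and Ren_tm t y x is t[y / x]. *)
Definition Subst_tm t n x : Tr :=
  \pi_Tr (psub (upd PVr x (repr n)) (repr t)).
Definition Ren_tm t y x : Tr := Subst_tm t (Vr y) x.
Definition FV_tm t : set V := [set` pfv (repr t)].
Definition Fresh_tm x t : Prop := ~ FV_tm t x.

Lemma Vr_cls x : Vr x = cls (PVr x). Proof. by []. Qed.

Lemma Ap_cls p q : Ap (cls p) (cls q) = cls (PAp p q).
Proof. by apply/clsP; constructor; exact: repr_cls. Qed.

Lemma Lm_cls x p : Lm x (cls p) = cls (PLm x p).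
Proof. by apply/clsP; apply: alpha_cLm; exact: repr_cls. Qed.

Lemma Perm_cls p sg : Perm_tm (cls p) sg = cls (pact sg p).
Proof. apply/clsP/alpha_pact; [exact: permI|exact: repr_cls]. Qed.

Lemma Subst_cls p q x : Subst_tm (cls p) (cls q) x = cls (psub (upd PVr x q) p).
Proof.
apply/clsP/alpha_psub; first exact: repr_cls.
by move=> u _; rewrite /upd; case: eqVneq => _; [exact: repr_cls|exact: alpha_refl].
Qed.

Lemma FV_cls p : FV_tm (cls p) = [set` pfv p].
Proof. by apply/seteqP; split=> x; have := alpha_fv (repr_cls p) x; rewrite /FV_tm /= => ->. Qed.

Lemma FV_finite t : finite_set (FV_tm t).
Proof. exact: finite_seq. Qed.

Lemma FV_Vr x : FV_tm (Vr x) = [set x].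
Proof.
rewrite Vr_cls FV_cls; apply/seteqP; split=> y /=; rewrite inE; first by move/eqP.
by move=> ->.
Qed.

Lemma FV_Ap t1 t2 : FV_tm (Ap t1 t2) = FV_tm t1 `|` FV_tm t2.
Proof.
elim/cls_ind: t1 => p; elim/cls_ind: t2 => q; rewrite Ap_cls !FV_cls.
by apply/seteqP; split=> y /=; rewrite mem_cat => /orP.
Qed.

Lemma FV_Lm x t : FV_tm (Lm x t) = FV_tm t `\ x.
Proof.
elim/cls_ind: t => p; rewrite Lm_cls !FV_cls.
apply/seteqP; split=> y /=; rewrite mem_filter.
  by move=> /andP[/eqP].
by move=> [yp /eqP ->].
Qed.

Lemma Tr_ind_fresh s (P : Tr -> Prop) :
  (forall x, P (Vr x)) ->
  (forall t1 t2, P t1 -> P t2 -> P (Ap t1 t2)) ->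
  (forall x t, x \notin s -> P t -> P (Lm x t)) ->
  forall t, P t.
Proof.
move=> PVr PAp PLm; elim/cls_ind => p.
suff H f : injective f -> P (cls (pact f p)) by move: (H id (fun _ _ => id)); rewrite pact_id.
elim: p f => [x|p IHp q IHq|x p IHp] f fI /=.
- exact: PVr.
- by rewrite -Ap_cls; apply: PAp; [exact: IHp|exact: IHq].
- have := freshP (s ++ pfv (pact f p)); move: (fresh _) => z.
  rewrite mem_cat negb_or => /andP[zs zp].
  have /clsP -> := alpha_Lm_swap (f x) zp.
  rewrite -Lm_cls pact_comp; apply: PLm => //; apply: IHp.
  by apply: inj_comp => //; exact: swapv_inj.
Qed.

Lemma Tr_ind (P : Tr -> Prop) :
  (forall x, P (Vr x)) ->
  (forall t1 t2, P t1 -> P t2 -> P (Ap t1 t2)) ->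
  (forall x t, P t -> P (Lm x t)) ->
  forall t, P t.
Proof. by move=> PV PA PL; apply: (@Tr_ind_fresh [::]) => // x t _; exact: PL. Qed.

Lemma Perm_Vr x sg : Perm_tm (Vr x) sg = Vr (sg x).
Proof. by rewrite !Vr_cls Perm_cls. Qed.

Lemma Perm_Ap t1 t2 sg : Perm_tm (Ap t1 t2) sg = Ap (Perm_tm t1 sg) (Perm_tm t2 sg).
Proof.
by elim/cls_ind: t1 => p; elim/cls_ind: t2 => q; rewrite Ap_cls !Perm_cls Ap_cls.
Qed.

Lemma Perm_Lm x t sg : Perm_tm (Lm x t) sg = Lm (sg x) (Perm_tm t sg).
Proof. by elim/cls_ind: t => p; rewrite Lm_cls !Perm_cls Lm_cls. Qed.

Lemma Perm_id t : Perm_tm t (perm_id V) = t.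
Proof. by elim/cls_ind: t => p; rewrite Perm_cls pact_id. Qed.

Lemma Perm_comp t sg ta : Perm_tm (Perm_tm t sg) ta = Perm_tm t (perm_comp ta sg).
Proof. by elim/cls_ind: t => p; rewrite !Perm_cls pact_comp. Qed.

Lemma Perm_fresh t sg : (forall x, FV_tm t x -> sg x = x) -> Perm_tm t sg = t.
Proof.
elim/cls_ind: t => p; rewrite FV_cls Perm_cls => sE; apply/clsP/pact_fresh => //.
exact: permI.
Qed.

Lemma FV_Perm t sg x : FV_tm (Perm_tm t sg) (sg x) <-> FV_tm t x.
Proof.
elim/cls_ind: t => p; rewrite Perm_cls !FV_cls /= pfv_pact; last exact: permI.
by rewrite mem_map//; exact: permI.
Qed.

Lemma Swap_fresh t x y : ~ FV_tm t x -> ~ FV_tm t y -> Swap_tm t x y = t.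
Proof.
move=> xt yt; apply: Perm_fresh => a at_ /=; rewrite swapvN//.
  by apply: contra_notN xt => /eqP <-.
by apply: contra_notN yt => /eqP <-.
Qed.

Lemma FV_Swap t x y z : FV_tm (Swap_tm t x y) z <-> FV_tm t (swapv x y z).
Proof. by have := FV_Perm t (transp x y) (swapv x y z); rewrite /= swapvK. Qed.

Lemma Lm_Swap x x' t : ~ FV_tm t x' -> Lm x t = Lm x' (Swap_tm t x' x).
Proof.
elim/cls_ind: t => p; rewrite FV_cls /Swap_tm Perm_cls !Lm_cls => /negP xp.
exact/clsP/alpha_Lm_swap.
Qed.

Lemma FV_infinite (t : Tr) : FV_tm t = [set x | infinite_set [set y | Swap_tm t x y <> t]].
Proof.
apply/seteqP; split=> x /=; last first.
  move=> inf; apply: contrapT => xt; apply: inf.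
  apply: sub_finite_set (FV_finite t) => y /= yt.
  by apply: contrapT => ny; apply: yt; exact: Swap_fresh.
move=> xt fin; apply: (@infinite_setT V).
rewrite (_ : [set: V] = FV_tm t `|` [set y | Swap_tm t x y <> t]).
  by rewrite finite_setU; split=> //; exact: FV_finite.
apply/seteqP; split=> y // _; have [yt|yt] := pselect (FV_tm t y); [by left|right].
move=> tE; apply: yt; rewrite -tE; apply/FV_Swap.
by rewrite swapvR.
Qed.

Lemma Subst_Vr x n z : Subst_tm (Vr x) n z = if x == z then n else Vr x.
Proof.
by elim/cls_ind: n => q; rewrite Vr_cls Subst_cls /= /upd; case: ifP.
Qed.

Lemma Subst_Ap t1 t2 n z :
  Subst_tm (Ap t1 t2) n z = Ap (Subst_tm t1 n z) (Subst_tm t2 n z).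
Proof.
elim/cls_ind: t1 => p; elim/cls_ind: t2 => q; elim/cls_ind: n => r.
by rewrite Ap_cls !Subst_cls Ap_cls.
Qed.

Lemma Subst_Lm x t n z : x != z -> ~ FV_tm n x ->
  Subst_tm (Lm x t) n z = Lm x (Subst_tm t n z).
Proof.
elim/cls_ind: t => p; elim/cls_ind: n => q.
rewrite FV_cls /= => xz /negP xq; rewrite Lm_cls !Subst_cls Lm_cls; apply/clsP.
apply: (@alpha_trans _ _ (PLm x (psub (upd (upd PVr z q) x (PVr x)) p))).
  apply: psub_Lm_any => u up ux; rewrite /upd; case: ifP => // _.
  by rewrite inE eq_sym.
apply: alpha_cLm; apply: psub_ext => u _; rewrite /upd; case: eqVneq => [->|_].
  by rewrite (negbTE xz); exact: alpha_refl.
exact: alpha_refl.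
Qed.

Lemma FV_seq t : exists s, forall x, x \notin s <-> ~ FV_tm t x.
Proof. by exists (pfv (repr t)) => x; split=> /negP. Qed.

Lemma Subst_fresh t n z : ~ FV_tm t z -> Subst_tm t n z = t.
Proof.
have [s sP] := FV_seq n.
elim/(@Tr_ind_fresh (z :: s)): t => [x|t1 t2 IH1 IH2|x t xs IH].
- rewrite FV_Vr Subst_Vr /= => zx.
  by case: eqVneq => // xz; exfalso; exact: zx.
- rewrite FV_Ap Subst_Ap => zt; rewrite IH1 ?IH2// => ?; apply: zt; [by right|by left].
- move: xs; rewrite inE negb_or => /andP[xz /sP xn]; rewrite FV_Lm => zt.
  rewrite Subst_Lm// IH// => ?; apply: zt; split=> //= zx.
  by rewrite zx eqxx in xz.
Qed.

Lemma Ren_Vr x y z : Ren_tm (Vr x) y z = Vr (renv y z x).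
Proof. by rewrite /Ren_tm Subst_Vr /renv; case: ifP. Qed.

Lemma Ren_Ap t1 t2 y z : Ren_tm (Ap t1 t2) y z = Ap (Ren_tm t1 y z) (Ren_tm t2 y z).
Proof. exact: Subst_Ap. Qed.

Lemma Ren_Lm x t y z : x != y -> x != z -> Ren_tm (Lm x t) y z = Lm x (Ren_tm t y z).
Proof.
move=> xy xz; apply: Subst_Lm => //; rewrite FV_Vr /= => e.
by rewrite e eqxx in xy.
Qed.

Lemma Ren_fresh t y z : ~ FV_tm t z -> Ren_tm t y z = t.
Proof. exact: Subst_fresh. Qed.

Lemma FV_Ren t y z : y != z -> ~ FV_tm (Ren_tm t y z) z.
Proof.
move=> yz; elim/(@Tr_ind_fresh [:: y; z]): t => [x|t1 t2 IH1 IH2|x t xs IH].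
- rewrite Ren_Vr FV_Vr /renv /=; case: eqVneq => [_|xz] e.
    by rewrite e eqxx in yz.
  by rewrite e eqxx in xz.
- by rewrite Ren_Ap FV_Ap => -[].
- move: xs; rewrite !inE negb_or => /andP[xy xz].
  by rewrite Ren_Lm// FV_Lm => -[].
Qed.

Lemma Ren_id t z : Ren_tm t z z = t.
Proof.
elim/(@Tr_ind_fresh [:: z]): t => [x|t1 t2 IH1 IH2|x t xs IH].
- by rewrite Ren_Vr /renv; case: eqVneq => [->|].
- by rewrite Ren_Ap IH1 IH2.
- by move: xs; rewrite inE => xz; rewrite Ren_Lm// IH.
Qed.

Lemma Ren_chain t x1 x2 x3 : ~ FV_tm t x2 ->
  Ren_tm (Ren_tm t x2 x1) x3 x2 = Ren_tm t x3 x1.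
Proof.
elim/(@Tr_ind_fresh [:: x1; x2; x3]): t => [x|t1 t2 IH1 IH2|x t xs IH].
- rewrite FV_Vr !Ren_Vr /renv /= => x2x; congr Vr.
  case: (eqVneq x x1) => [_|xx1]; first by rewrite eqxx.
  by case: eqVneq => // e; exfalso; apply: x2x.
- rewrite FV_Ap !Ren_Ap => xt; rewrite IH1 ?IH2// => ?; apply: xt; [by right|by left].
- move: xs; rewrite !inE !negb_or => /and3P[xx1 xx2 xx3].
  rewrite FV_Lm => xt; rewrite !Ren_Lm// IH// => ?; apply: xt; split=> //= e.
  by rewrite e eqxx in xx2.
Qed.

Lemma Ren_comm t x1 x2 y1 y2 : x2 != y1 -> y1 != x1 -> x1 != y2 ->
  Ren_tm (Ren_tm t x2 x1) y2 y1 = Ren_tm (Ren_tm t y2 y1) x2 x1.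
Proof.
move=> xy yx xy2.
elim/(@Tr_ind_fresh [:: x1; x2; y1; y2]): t => [x|t1 t2 IH1 IH2|x t xs IH].
- rewrite !Ren_Vr /renv; congr Vr.
  case: (eqVneq x x1) => [->|xx1].
    by rewrite (negbTE xy) [x1 == y1]eq_sym (negbTE yx) eqxx.
  case: (eqVneq x y1) => [_|xy1]; first by rewrite [y2 == x1]eq_sym (negbTE xy2).
  by rewrite (negbTE xx1).
- by rewrite !Ren_Ap IH1 IH2.
- move: xs; rewrite !inE !negb_or => /and4P[? ? ? ?].
  by rewrite !Ren_Lm// IH.
Qed.

Lemma Ren_Swap t x x' : ~ FV_tm t x' -> Ren_tm t x' x = Swap_tm t x' x.
Proof.
elim/(@Tr_ind_fresh [:: x; x']): t => [y|t1 t2 IH1 IH2|y t xs IH].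
- rewrite FV_Vr Ren_Vr /Swap_tm Perm_Vr /renv /= /swapv => xy; congr Vr.
  by case: (eqVneq y x') => // e; exfalso; apply: xy.
- rewrite FV_Ap Ren_Ap /Swap_tm Perm_Ap => xt.
  by rewrite IH1 ?IH2// => ?; apply: xt; [right|left].
- move: xs; rewrite !inE !negb_or => /andP[yx yx'].
  rewrite FV_Lm => xt; rewrite Ren_Lm// IH; first by rewrite /Swap_tm Perm_Lm /= swapvN.
  by move=> ?; apply: xt; split=> //= e; rewrite e eqxx in yx'.
Qed.

Lemma Lm_Ren x x' t : ~ FV_tm t x' -> Lm x t = Lm x' (Ren_tm t x' x).
Proof. by move=> xt; rewrite Ren_Swap//; exact: Lm_Swap. Qed.

End Terms.

Record category := Category {
  obj :> Type;
  hom : obj -> obj -> Type;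
  idm : forall A, hom A A;
  comp : forall A B C, hom B C -> hom A B -> hom A C;
  comp1m : forall A B (f : hom A B), comp (idm B) f = f;
  compm1 : forall A B (f : hom A B), comp f (idm A) = f;
  compA : forall A B C D (h : hom C D) (g : hom B C) (f : hom A B),
    comp h (comp g f) = comp (comp h g) f
}.
Arguments hom {c}.
Arguments idm {c}.
Arguments comp {c A B C}.

Record functor (C D : category) := Functor {
  fobj :> C -> D;
  fmap : forall A B, hom A B -> hom (fobj A) (fobj B);
  fmap_id : forall A, fmap (idm A) = idm (fobj A);
  fmap_comp : forall A B E (g : hom B E) (f : hom A B),
    fmap (comp g f) = comp (fmap g) (fmap f)
}.

(* ini_mor and ini_mor_uniq say that ini is an initial object of ext. *)
Record epi_recursor (B : category) (T : B) := EpiRecursor {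
  ext : category;
  ini : ext;
  ini_mor : forall C : ext, hom ini C;
  ini_mor_uniq : forall (C : ext) (f : hom ini C), f = ini_mor C;
  frg : functor ext B;
  frg_ini : frg ini = T
}.

(* castm transports a morphism along equalities of objects: it is needed because
   frg ini = T and frg C = X are equalities between objects of B. *)
Definition castm (C : category) (A A' B B' : C) (eA : A = A') (eB : B = B')
    (f : hom A B) : hom A' B' :=
  match eA in _ = X, eB in _ = Y return hom X Y with erefl, erefl => f end.

Definition definable (B : category) (T : B) (r : epi_recursor T)
    (X : B) (g : hom T X) : Prop :=
  exists (C : ext r) (e : frg r C = X),
    g = castm (frg_ini r) e (fmap (frg r) (ini_mor C)).

(* The full subcategory is given by its class seg of objects. *)
Record initial_segment (C : category) := InitialSegment {
  seg : C -> Prop;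
  seg_o : C -> C;
  seg_o_in : forall X, seg (seg_o X);
  seg_m : forall X, hom (seg_o X) X
}.

Definition quasi_stronger (B : category) (T : B) (r' r : epi_recursor T) : Prop :=
  exists S : initial_segment B, forall (X : B) (g : hom T X), definable r g ->
    exists2 g0 : hom T (seg_o S X), definable r' g0 & g = comp (seg_m S X) g0.

Definition quasi_equiv (B : category) (T : B) (r r' : epi_recursor T) : Prop :=
  quasi_stronger r r' /\ quasi_stronger r' r.

Inductive symbol := vr | ap | lm | pm | sw | sb | ren | fv | fr.

Scheme Equality for symbol.

Lemma symbol_eqP : Equality.axiom symbol_beq.
Proof. by move=> s t; apply: (iffP idP) => [|->]; [case: s; case: t|case: t]. Qed.

HB.instance Definition _ := hasDecEq.Build symbol symbol_eqP.

Definition signature := pred symbol.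

Definition sig_ctor : signature := mem [:: vr; ap; lm].

Section Models.
Variable V : varType.
Implicit Types (x y z : V).

(* The arguments come in the order of the notations: the operations sw, sb and
   ren map m x y to m[x /\ y], m n x to m[n / x] and m y x to m[y / x]. *)
Definition op_type (M : Type) (s : symbol) : Type :=
  match s with
  | vr => V -> M
  | ap => M -> M -> M
  | lm => V -> M -> M
  | pm => M -> perm V -> M
  | sw => M -> V -> V -> M
  | sb => M -> M -> V -> M
  | ren => M -> V -> V -> M
  | fv => M -> set V
  | fr => V -> M -> Prop
  end.

Record model (S : signature) := Model {
  carrier :> Type;
  op : forall s, s \in S -> op_type carrier s
}.

Definition op_morph (M M' : Type) (g : M -> M') (s : symbol) :
    op_type M s -> op_type M' s -> Prop :=
  match s with
  | vr => fun o o' => forall x, g (o x) = o' x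
  | ap => fun o o' => forall m n, g (o m n) = o' (g m) (g n)
  | lm => fun o o' => forall x m, g (o x m) = o' x (g m)
  | pm => fun o o' => forall m p, g (o m p) = o' (g m) p
  | sw => fun o o' => forall m x y, g (o m x y) = o' (g m) x y
  | sb => fun o o' => forall m n x, g (o m n x) = o' (g m) (g n) x
  | ren => fun o o' => forall m y x, g (o m y x) = o' (g m) y x
  | fv => fun o o' => forall m, o' (g m) `<=` o m
  | fr => fun o o' => forall x m, o x m -> o' x (g m)
  end.

Record model_hom (S : signature) (M M' : model S) := ModelHom {
  mfun :> M -> M';
  mfunP : forall s (h : s \in S), op_morph mfun (op M h) (op M' h)
}.

Lemma model_hom_ext S (M M' : model S) (f g : model_hom M M') : f =1 g -> f = g.
Proof.
case: f g => [f fP] [g gP] /= fg; have e : f = g by exact/funext.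
by subst g; rewrite (Prop_irrelevance fP gP).
Qed.

Lemma op_morph_id (M : Type) s (o : op_type M s) : op_morph id o o.
Proof. by case: s o => //= o m x. Qed.

Lemma op_morph_comp (M M' M'' : Type) (f : M -> M') (g : M' -> M'') s
    (o : op_type M s) (o' : op_type M' s) (o'' : op_type M'' s) :
  op_morph f o o' -> op_morph g o' o'' -> op_morph (g \o f) o o''.
Proof.
case: s o o' o'' => /= o o' o'' fP gP; do ?by [move=> *; rewrite fP gP].
- by move=> m; exact: subset_trans (gP _) (fP _).
- by move=> x m oxm; exact: gP (fP _ _ oxm).
Qed.

Definition model_id S (M : model S) : model_hom M M :=
  ModelHom (fun s h => op_morph_id (op M h)).

Definition model_comp S (M M' M'' : model S) (g : model_hom M' M'')
    (f : model_hom M M') : model_hom M M'' :=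
  ModelHom (fun s h => op_morph_comp (mfunP f h) (mfunP g h)).

Definition model_cat (S : signature) : category.
Proof.
apply: (@Category (model S) (@model_hom S) (@model_id S) (@model_comp S)).
- by move=> A B f; exact: model_hom_ext.
- by move=> A B f; exact: model_hom_ext.
- by move=> A B C D h g f; exact: model_hom_ext.
Defined.

Definition std_op (s : symbol) : op_type (Tr V) s :=
  match s with
  | vr => @Vr V
  | ap => @Ap V
  | lm => @Lm V
  | pm => @Perm_tm V
  | sw => @Swap_tm V
  | sb => @Subst_tm V
  | ren => @Ren_tm V
  | fv => @FV_tm V
  | fr => @Fresh_tm V
  end.

Definition TrM (S : signature) : model S :=
  @Model S (Tr V) (fun s _ => std_op s).

(* A property comes with the symbols that occur in it, and it is interpreted in
   any structure that provides operations for these symbols. *)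
Record property := Property {
  occ : seq symbol;
  interp : forall M : Type, (forall s, s \in occ -> op_type M s) -> Prop
}.

Definition SwVr := Property (occ := [:: vr; sw]) (fun M o =>
  let Vr := o vr isT in let Sw := o sw isT in
  forall x z1 z2, Sw (Vr x) z1 z2 = Vr (swapv z1 z2 x)).

Definition SwAp := Property (occ := [:: ap; sw]) (fun M o =>
  let Ap := o ap isT in let Sw := o sw isT in
  forall m1 m2 z1 z2, Sw (Ap m1 m2) z1 z2 = Ap (Sw m1 z1 z2) (Sw m2 z1 z2)).

Definition SwLm := Property (occ := [:: lm; sw]) (fun M o =>
  let Lm := o lm isT in let Sw := o sw isT in
  forall x m z1 z2, Sw (Lm x m) z1 z2 = Lm (swapv z1 z2 x) (Sw m z1 z2)).

Definition SwId := Property (occ := [:: sw]) (fun M o =>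
  let Sw := o sw isT in
  forall m z, Sw m z z = m).

Definition SwIv := Property (occ := [:: sw]) (fun M o =>
  let Sw := o sw isT in
  forall m x y, Sw (Sw m x y) x y = m).

Definition SwCp := Property (occ := [:: sw]) (fun M o =>
  let Sw := o sw isT in
  forall m x y z1 z2,
    Sw (Sw m x y) z1 z2 = Sw (Sw m z1 z2) (swapv z1 z2 x) (swapv z1 z2 y)).

Definition SwFv := Property (occ := [:: sw; fv]) (fun M o =>
  let Sw := o sw isT in let FV := o fv isT in
  forall m x y, ~ FV m x -> ~ FV m y -> Sw m x y = m).

Definition SwCg := Property (occ := [:: lm; sw; fr]) (fun M o =>
  let Lm := o lm isT in let Sw := o sw isT in let Fr := o fr isT in
  forall m1 m2 x1 x2 z, z <> x1 -> z <> x2 -> Fr z m1 -> Fr z m2 ->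
    Sw m1 z x1 = Sw m2 z x2 -> Lm x1 m1 = Lm x2 m2).

Definition SwBvr := Property (occ := [:: lm; sw; fr]) (fun M o =>
  let Lm := o lm isT in let Sw := o sw isT in let Fr := o fr isT in
  forall x x' m, x' <> x -> Fr x' m -> Lm x m = Lm x' (Sw m x' x)).

Definition PmVr := Property (occ := [:: vr; pm]) (fun M o =>
  let Vr := o vr isT in let Pm := o pm isT in
  forall x p, Pm (Vr x) p = Vr (p x)).

Definition PmAp := Property (occ := [:: ap; pm]) (fun M o =>
  let Ap := o ap isT in let Pm := o pm isT in
  forall m1 m2 p, Pm (Ap m1 m2) p = Ap (Pm m1 p) (Pm m2 p)).

Definition PmLm := Property (occ := [:: lm; pm]) (fun M o =>
  let Lm := o lm isT in let Pm := o pm isT in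
  forall x m p, Pm (Lm x m) p = Lm (p x) (Pm m p)).

Definition PmId := Property (occ := [:: pm]) (fun M o =>
  let Pm := o pm isT in
  forall m, Pm m (perm_id V) = m).

Definition PmCp := Property (occ := [:: pm]) (fun M o =>
  let Pm := o pm isT in
  forall m p q, Pm (Pm m p) q = Pm m (perm_comp q p)).

Definition PmFv := Property (occ := [:: pm; fv]) (fun M o =>
  let Pm := o pm isT in let FV := o fv isT in
  forall m (p : perm V), supp p `&` FV m = set0 -> Pm m p = m).

Definition SbVr := Property (occ := [:: vr; sb]) (fun M o =>
  let Vr := o vr isT in let Sb := o sb isT in
  forall x n z, Sb (Vr x) n z = if x == z then n else Vr x).

Definition SbAp := Property (occ := [:: ap; sb]) (fun M o =>
  let Ap := o ap isT in let Sb := o sb isT in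
  forall m1 m2 n z, Sb (Ap m1 m2) n z = Ap (Sb m1 n z) (Sb m2 n z)).

Definition SbLm := Property (occ := [:: lm; sb; fr]) (fun M o =>
  let Lm := o lm isT in let Sb := o sb isT in let Fr := o fr isT in
  forall x m n z, x <> z -> Fr x n -> Sb (Lm x m) n z = Lm x (Sb m n z)).

Definition SbBvr := Property (occ := [:: vr; lm; sb; fr]) (fun M o =>
  let Vr := o vr isT in let Lm := o lm isT in
  let Sb := o sb isT in let Fr := o fr isT in
  forall x x' m, x' <> x -> Fr x' m -> Lm x m = Lm x' (Sb m (Vr x') x)).

Definition RnVr := Property (occ := [:: vr; ren]) (fun M o =>
  let Vr := o vr isT in let Rn := o ren isT in
  forall x y z, Rn (Vr x) y z = Vr (renv y z x)).

Definition RnAp := Property (occ := [:: ap; ren]) (fun M o =>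
  let Ap := o ap isT in let Rn := o ren isT in
  forall m1 m2 y z, Rn (Ap m1 m2) y z = Ap (Rn m1 y z) (Rn m2 y z)).

Definition RnLm1 := Property (occ := [:: lm; ren]) (fun M o =>
  let Lm := o lm isT in let Rn := o ren isT in
  forall x m y z, x <> y -> x <> z -> Rn (Lm x m) y z = Lm x (Rn m y z)).

Definition RnLm2 := Property (occ := [:: lm; ren]) (fun M o =>
  let Lm := o lm isT in let Rn := o ren isT in
  forall x m z, Rn (Lm x m) z x = Lm x m).

Definition RnBvr := Property (occ := [:: lm; ren; fr]) (fun M o =>
  let Lm := o lm isT in let Rn := o ren isT in let Fr := o fr isT in
  forall x x' m, x' <> x -> Fr x' m -> Lm x m = Lm x' (Rn m x' x)).

Definition RnBvr2 := Property (occ := [:: lm; ren]) (fun M o =>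
  let Lm := o lm isT in let Rn := o ren isT in
  forall x x' y m, y <> x' -> Lm x (Rn m y x') = Lm x' (Rn (Rn m y x') x' x)).

Definition RnId := Property (occ := [:: ren]) (fun M o =>
  let Rn := o ren isT in
  forall m z, Rn m z z = m).

Definition RnIm := Property (occ := [:: ren]) (fun M o =>
  let Rn := o ren isT in
  forall m x1 x2 y, x1 <> y -> Rn (Rn m x1 y) x2 y = Rn m x1 y).

Definition RnCh := Property (occ := [:: ren]) (fun M o =>
  let Rn := o ren isT in
  forall m y x1 x2 x3, y <> x2 ->
    Rn (Rn (Rn m y x2) x2 x1) x3 x2 = Rn (Rn m y x2) x3 x1).

Definition RnCm := Property (occ := [:: ren]) (fun M o =>
  let Rn := o ren isT in
  forall m x1 x2 y1 y2, x2 <> y1 -> y1 <> x1 -> x1 <> y2 ->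
    Rn (Rn m x2 x1) y2 y1 = Rn (Rn m y2 y1) x2 x1).

Definition FrVr := Property (occ := [:: vr; fr]) (fun M o =>
  let Vr := o vr isT in let Fr := o fr isT in
  forall x z, z <> x -> Fr z (Vr x)).

Definition FrAp := Property (occ := [:: ap; fr]) (fun M o =>
  let Ap := o ap isT in let Fr := o fr isT in
  forall m1 m2 z, Fr z m1 -> Fr z m2 -> Fr z (Ap m1 m2)).

Definition FrLm := Property (occ := [:: lm; fr]) (fun M o =>
  let Lm := o lm isT in let Fr := o fr isT in
  forall x m z, z = x \/ Fr z m -> Fr z (Lm x m)).

Definition FvVr := Property (occ := [:: vr; fv]) (fun M o =>
  let Vr := o vr isT in let FV := o fv isT in
  forall x, FV (Vr x) `<=` [set x]).

Definition FvAp := Property (occ := [:: ap; fv]) (fun M o =>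
  let Ap := o ap isT in let FV := o fv isT in
  forall m1 m2, FV (Ap m1 m2) `<=` FV m1 `|` FV m2).

Definition FvLm := Property (occ := [:: lm; fv]) (fun M o =>
  let Lm := o lm isT in let FV := o fv isT in
  forall x m, FV (Lm x m) `<=` FV m `\ x).

Definition FvDPm := Property (occ := [:: pm; fv]) (fun M o =>
  let Pm := o pm isT in let FV := o fv isT in
  forall m, FV m = [set x | infinite_set [set y | Pm m (transp x y) <> m]]).

Definition FvDSw := Property (occ := [:: sw; fv]) (fun M o =>
  let Sw := o sw isT in let FV := o fv isT in
  forall m, FV m = [set x | infinite_set [set y | Sw m x y <> m]]).

Definition FCB := Property (occ := [:: lm; fv]) (fun M o =>
  let Lm := o lm isT in let FV := o fv isT in
  exists x, forall m, ~ FV (Lm x m) x).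

Definition Props1 := [:: PmVr; PmAp; PmLm; PmId; PmCp; FvDPm; FCB].
Definition Props2 := [:: PmVr; PmAp; PmLm; PmId; PmCp; PmFv; FvVr; FvAp; FvLm].
Definition Props3 := [:: SwVr; SwAp; SwLm; SwId; SwIv; SwCp; FvDSw; FCB].
Definition Props4 := [:: SwVr; SwAp; SwLm; SwFv; FvVr; FvAp; FvLm].
Definition Props5 := [:: SwVr; SwAp; SwLm; SwBvr; FrVr; FrAp; FrLm].
Definition Props6 := [:: SwVr; SwAp; SwLm; SwCg; FrVr; FrAp; FrLm].
Definition Props7 := [:: SbVr; SbAp; SbLm; SbBvr; FrVr; FrAp; FrLm].
Definition Props8 :=
  [:: RnVr; RnAp; RnLm1; RnLm2; RnBvr2; RnId; RnIm; RnCh; RnCm].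
Definition Props9 := [:: RnVr; RnAp; RnLm1; RnBvr; FrVr; FrAp; FrLm].

Definition sig_of (Ps : seq property) : signature :=
  mem (flatten [seq occ P | P <- Ps]).

Lemma occ_sub Ps P : List.In P Ps -> {subset occ P <= sig_of Ps}.
Proof.
rewrite /sig_of => + s sP; elim: Ps => //= Q Ps IH [->|/IH]; rewrite !inE mem_cat.
  by rewrite sP.
by move=> ->; rewrite orbT.
Qed.

Definition satisfies (S : signature) (M : model S) (P : property)
    (h : {subset occ P <= S}) : Prop :=
  interp (fun s (sP : s \in occ P) => op M (h s sP)).

Record pmodel (Ps : seq property) := PModel {
  pmodel_model :> model (sig_of Ps);
  pmodelP : forall P (h : List.In P Ps), satisfies pmodel_model (occ_sub h)
}.

Definition pmodel_cat (Ps : seq property) : category.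
Proof.
apply: (@Category (pmodel Ps) (fun M N => model_hom M N)
  (fun M => model_id M) (fun L M N => @model_comp _ L M N)).
- by move=> A B f; exact: model_hom_ext.
- by move=> A B f; exact: model_hom_ext.
- by move=> A B C D h g f; exact: model_hom_ext.
Defined.

Definition reduct (S S' : signature) (h : {subset S <= S'}) (M : model S') : model S :=
  @Model S M (fun s sS => op M (h s sS)).

Definition reduct_hom (S S' : signature) (h : {subset S <= S'}) (M N : model S')
    (f : model_hom M N) : model_hom (reduct h M) (reduct h N) :=
  @ModelHom _ (reduct h M) (reduct h N) f (fun s sS => mfunP f (h s sS)).

Definition forget (Ps : seq property) (h : {subset sig_ctor <= sig_of Ps}) :
  functor (pmodel_cat Ps) (model_cat sig_ctor).
Proof.
apply: (@Functor (pmodel_cat Ps) (model_cat sig_ctor)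
  (fun M : pmodel Ps => reduct h M) (fun M N f => reduct_hom h f)).
- by move=> M; exact: model_hom_ext.
- by move=> L M N g f; exact: model_hom_ext.
Defined.

End Models.

Section Initiality.
Variable V : varType.
Implicit Types (x y z : V) (p q : preterm V) (t : Tr V).

Section Conj.
Variables (A : Type) (Q : A -> Prop).

Fixpoint conj_all (l : seq A) : Prop :=
  if l is a :: l then Q a /\ conj_all l else True.

Lemma conj_allP l : (forall a, List.In a l -> Q a) <-> conj_all l.
Proof.
elim: l => [|a l IH] /=; first by split.
split=> [H|[Qa /IH H] b [<-//|/H//]].
by split; [apply: H; left|apply/IH => b bl; apply: H; right].
Qed.
End Conj.

(* Proof device: structures with operations for all symbols, so that the
   sets of properties can be compared by changing single operations. *)
Definition sat_all (M : Type) (o : forall s, op_type V M s) : seq (property V) -> Prop :=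
  conj_all (fun P => interp (p := P) (fun s _ => o s)).

Definition mkops (M : Type) (ovr : op_type V M vr) (oap : op_type V M ap)
    (olm : op_type V M lm) (opm : op_type V M pm) (osw : op_type V M sw)
    (osb : op_type V M sb) (oren : op_type V M ren) (ofv : op_type V M fv)
    (ofr : op_type V M fr) (s : symbol) : op_type V M s :=
  match s with
  | vr => ovr | ap => oap | lm => olm | pm => opm | sw => osw
  | sb => osb | ren => oren | fv => ofv | fr => ofr
  end.

Section Model.
Variables (M : Type) (o : forall s, op_type V M s).
Notation mVr := (o vr).
Notation mAp := (o ap).
Notation mLm := (o lm).
Notation mFr := (o fr).

Definition ctor_morph (g : Tr V -> M) : Prop :=
  [/\ forall x, g (Vr x) = mVr x,
      forall t1 t2, g (Ap t1 t2) = mAp (g t1) (g t2) &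
      forall x t, g (Lm x t) = mLm x (g t)].

Lemma ctor_morph_uniq g h : ctor_morph g -> ctor_morph h -> g =1 h.
Proof.
move=> [g1 g2 g3] [h1 h2 h3]; elim/(@Tr_ind V) => [x|t1 t2 IH1 IH2|x t IH].
- by rewrite g1 h1.
- by rewrite g2 h2 IH1 IH2.
- by rewrite g3 h3 IH.
Qed.

(* Recursion on preterms; it yields a function on terms when it respects alpha. *)
Fixpoint prec p : M :=
  match p with
  | PVr x => mVr x
  | PAp p q => mAp (prec p) (prec q)
  | PLm x p => mLm x (prec p)
  end.

Lemma prec_lift : (forall p q, alpha p q -> prec p = prec q) ->
  exists g, ctor_morph g.
Proof.
move=> precE; exists (fun t => prec (generic_quotient.repr t)).
have precK p : prec (generic_quotient.repr (cls p)) = prec p.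
  exact/precE/repr_cls.
split=> [x|t1 t2|x t]; first exact: (precK (PVr x)).
- exact: (precK (PAp _ _)).
- exact: (precK (PLm _ _)).
Qed.

Lemma prec_fr : sat_all o [:: FrVr V; FrAp V; FrLm V] ->
  forall p z, z \notin pfv p -> mFr z (prec p).
Proof.
move=> /= [frv [fra [frl _]]]; elim=> [x|p IHp q IHq|x p IHp] z /=.
- by rewrite inE => /eqP; exact: frv.
- by rewrite mem_cat negb_or => /andP[/IHp ? /IHq ?]; exact: fra.
- rewrite mem_filter negb_and negbK => zp; apply: frl.
  by case/orP: zp => [/eqP|/IHp]; [left|right].
Qed.

Lemma ctor_fr g : sat_all o [:: FrVr V; FrAp V; FrLm V] ->
  ctor_morph g -> forall t z, Fresh_tm z t -> mFr z (g t).
Proof.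
move=> /= [frv [fra [frl _]]] [g1 g2 g3].
elim/(@Tr_ind V) => [x|t1 t2 IH1 IH2|x t IH] z; rewrite /Fresh_tm.
- by rewrite FV_Vr g1 => ?; exact: frv.
- by rewrite FV_Ap g2 => zt; apply: fra; [apply: IH1|apply: IH2] => ?; apply: zt; [left|right].
- rewrite FV_Lm g3 => zt; apply: frl; case: (eqVneq z x) => [|/eqP zx]; [by left|right].
  by apply: IH => ?; apply: zt.
Qed.

Lemma ctor_fv g : sat_all o [:: FvVr V; FvAp V; FvLm V] ->
  ctor_morph g -> forall t, o fv (g t) `<=` FV_tm t.
Proof.
move=> /= [frv [fra [frl _]]] [g1 g2 g3].
elim/(@Tr_ind V) => [x|t1 t2 IH1 IH2|x t IH].
- by rewrite FV_Vr g1; exact: frv.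
- by rewrite FV_Ap g2; apply: subset_trans (fra _ _) _; exact: setUSS.
- rewrite FV_Lm g3; apply: subset_trans (frl _ _) _; exact: setSD.
Qed.

Lemma ctor_pm g : sat_all o [:: PmVr V; PmAp V; PmLm V] ->
  ctor_morph g -> forall t (s : perm V), g (Perm_tm t s) = o pm (g t) s.
Proof.
move=> /= [pv [pa [pl _]]] [g1 g2 g3] + s.
elim/(@Tr_ind V) => [x|t1 t2 IH1 IH2|x t IH].
- by rewrite Perm_Vr !g1 pv.
- by rewrite Perm_Ap !g2 pa IH1 IH2.
- by rewrite Perm_Lm !g3 pl IH.
Qed.

Lemma ctor_sw g : sat_all o [:: SwVr V; SwAp V; SwLm V] ->
  ctor_morph g -> forall t x y, g (Swap_tm t x y) = o sw (g t) x y.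
Proof.
move=> /= [pv [pa [pl _]]] [g1 g2 g3] + x y; rewrite /Swap_tm.
elim/(@Tr_ind V) => [z|t1 t2 IH1 IH2|z t IH].
- by rewrite Perm_Vr !g1 pv.
- by rewrite Perm_Ap !g2 pa IH1 IH2.
- by rewrite Perm_Lm !g3 pl IH.
Qed.

Lemma ctor_ren g : sat_all o [:: RnVr V; RnAp V; RnLm1 V] ->
  ctor_morph g -> forall t y x, g (Ren_tm t y x) = o ren (g t) y x.
Proof.
move=> /= [pv [pa [pl _]]] [g1 g2 g3] + y x.
elim/(@Tr_ind_fresh V [:: y; x]) => [z|t1 t2 IH1 IH2|z t].
- by rewrite Ren_Vr !g1 pv.
- by rewrite Ren_Ap !g2 pa IH1 IH2.
- rewrite !inE negb_or => /andP[zy zx] IH.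
  by rewrite Ren_Lm// !g3 pl ?IH//; apply/eqP.
Qed.

Lemma ctor_sb g : sat_all o [:: FrVr V; FrAp V; FrLm V] ->
  sat_all o [:: SbVr V; SbAp V; SbLm V] ->
  ctor_morph g -> forall t n x, g (Subst_tm t n x) = o sb (g t) (g n) x.
Proof.
move=> frs /= [pv [pa [pl _]]] gm + n x; have gfr := ctor_fr frs gm.
have [s sP] := FV_seq n; case: gm => g1 g2 g3.
elim/(@Tr_ind_fresh V (x :: s)) => [z|t1 t2 IH1 IH2|z t].
- by rewrite Subst_Vr g1 pv; case: ifP.
- by rewrite Subst_Ap !g2 pa IH1 IH2.
- rewrite !inE negb_or => /andP[zx /sP zn] IH.
  by rewrite Subst_Lm// !g3 pl ?IH//; [apply/eqP|exact: gfr].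
Qed.

Lemma swap_rec : sat_all o (Props6 V) -> exists g, ctor_morph g.
Proof.
move=> /= [sv [sa [sl [scg [frv [fra [frl _]]]]]]].
have pfr := prec_fr (conj frv (conj fra (conj frl I))).
have psw p x y : prec (pact (swapv x y) p) = o sw (prec p) x y.
  by elim: p => [z|p IHp q IHq|z p IHp] /=; rewrite ?sv ?sa ?sl ?IHp ?IHq.
apply: prec_lift => p q; elim=> [//|? ? ? ? _ + _ +|x p1 y p2 z zP _ IH] /=.
  by move=> -> ->.
rewrite !psw in IH; apply: scg IH.
all: move: zP; rewrite !inE mem_cat !negb_or => /and4P[/eqP ? /eqP ? zp zq] //.
- by apply: pfr; apply: contraNN zp; exact: pfv_pvars.
- by apply: pfr; apply: contraNN zq; exact: pfv_pvars.
Qed.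

Fixpoint psize p : nat :=
  match p with
  | PVr _ => 0
  | PAp p q => (psize p + psize q).+1
  | PLm _ p => (psize p).+1
  end.

Lemma psize_pact f p : psize (pact f p) = psize p.
Proof. by elim: p => [x|p IHp q IHq|x p IHp] //=; rewrite ?IHp ?IHq. Qed.

Lemma ren_rec : sat_all o (Props9 V) -> exists g, ctor_morph g.
Proof.
move=> /= [rv [ra [rl [rb [frv [fra [frl _]]]]]]].
have pfr := prec_fr (conj frv (conj fra (conj frl I))).
have pfr' p z : z \notin pvars p -> mFr z (prec p).
  by move=> zp; apply: pfr; apply: contraNN zp; exact: pfv_pvars.
have core n : forall p, psize p <= n ->
    (forall x z, x \notin pfv p -> o ren (prec p) z x = prec p) /\
    (forall x z, z != x -> z \notin pvars p ->
       prec (pact (swapv z x) p) = o ren (prec p) z x).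
  elim: n => [|n IH] [y|p q|y p] //=.
  - move=> _; split=> [x z|x z zx]; rewrite inE => xy; rewrite rv /renv.
      by rewrite eq_sym (negbTE xy).
    by rewrite /swapv eq_sym (negbTE xy).
  - move=> _; split=> [x z|x z zx]; rewrite inE => xy; rewrite rv /renv.
      by rewrite eq_sym (negbTE xy).
    by rewrite /swapv eq_sym (negbTE xy).
  - rewrite ltnS => pq.
    have [Ap1 Bp] := IH p (leq_trans (leq_addr _ _) pq).
    have [Aq Bq] := IH q (leq_trans (leq_addl _ _) pq).
    split=> [x z|x z zx]; rewrite mem_cat negb_or => /andP[xp xq]; rewrite ra.
      by rewrite Ap1 ?Aq.
    by rewrite Bp ?Bq.
  rewrite ltnS => pn; have [Ap1 Bp] := IH p pn.
  have A1 x z : x \notin [seq a <- pfv p | a != y] ->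
      o ren (mLm y (prec p)) z x = mLm y (prec p).
    move=> xp; have := freshP [:: x, z, y & pvars p]; move: (fresh _) => u.
    rewrite !inE !negb_or => /and4P[ux uz uy up].
    have -> : mLm y (prec p) = mLm u (prec (pact (swapv u y) p)).
      by rewrite Bp//; apply: rb; [exact/eqP|exact: pfr'].
    rewrite rl; [|exact/eqP|exact/eqP]; congr (mLm u _).
    have sz : psize (pact (swapv u y) p) <= n by rewrite psize_pact.
    have [-> //] := IH _ sz.
    rewrite pfv_pact; last exact: swapv_inj.
    apply/negP => /mapP[a ap xa]; move: xp; rewrite mem_filter.
    have [ay|ay] := eqVneq a y; first by rewrite xa ay swapvR eqxx in ux.
    have au : a != u.
      by apply: contraTneq ap => ->; apply: contraNN up; exact: pfv_pvars.
    by rewrite xa swapvN// ay ap.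
  split=> // x z zx; rewrite inE negb_or => /andP[zy zp].
  rewrite Bp//; have [yx|yx] := eqVneq y x.
    subst y; rewrite swapvR -rb; [|exact/eqP|exact: pfr'].
    by rewrite A1// mem_filter eqxx.
  rewrite swapvN//; last by rewrite eq_sym.
  by rewrite rl//; apply/eqP => //; rewrite eq_sym.
apply: prec_lift => p q; elim=> [//|? ? ? ? _ + _ +|x p1 y p2 z zP _ IH] /=.
  by move=> -> ->.
move: zP; rewrite !inE mem_cat !negb_or => /and4P[zx zy zp zq].
have [_ B1] := core _ p1 (leqnn _); have [_ B2] := core _ p2 (leqnn _).
rewrite (rb x z); [|exact/eqP|exact: pfr'].
rewrite (rb y z); [|exact/eqP|exact: pfr'].
by rewrite -B1// -B2// IH.
Qed.

End Model.

Section Transfer.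
Variables (M : Type) (o : forall s, op_type V M s).

Definition swapops (osw : op_type V M sw) : forall s, op_type V M s :=
  mkops (o vr) (o ap) (o lm) (o pm) osw (o sb) (o ren) (o fv) (o fr).

Definition renops (oren : op_type V M ren) : forall s, op_type V M s :=
  mkops (o vr) (o ap) (o lm) (o pm) (o sw) (o sb) oren (o fv) (o fr).

Definition frops (ofr : op_type V M fr) : forall s, op_type V M s :=
  mkops (o vr) (o ap) (o lm) (o pm) (o sw) (o sb) (o ren) (o fv) ofr.

Lemma rec6 : sat_all o (Props6 V) -> exists g, ctor_morph o g.
Proof. exact: swap_rec. Qed.

Lemma rec9 : sat_all o (Props9 V) -> exists g, ctor_morph o g.
Proof. exact: ren_rec. Qed.

Lemma rec7 : sat_all o (Props7 V) -> exists g, ctor_morph o g.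
Proof.
move=> /= [sv [sa [sl [sb_ [frv [fra [frl _]]]]]]].
apply: (@ren_rec _ (renops (fun m y z => o sb m (o vr y) z))).
do !split => //=.
- by move=> x y z; rewrite sv /renv; case: ifP.
- by move=> x m y z xy xz; apply: sl => //; exact: frv.
Qed.

Lemma rec8 : sat_all o (Props8 V) -> exists g, ctor_morph o g.
Proof.
move=> /= [rv [ra [rl [rl2 [rb [ri [rm [rc [rcm _]]]]]]]]].
pose F x m := exists2 y, y <> x & o ren m y x = m.
have FE x m y : F x m -> o ren m y x = m.
  by move=> [y' y'x e]; rewrite -{1}e rm.
have neq (s : seq V) : exists y, y \notin s by exact: fresh_exists.
apply: (@ren_rec _ (frops F)).
do !split => //=.
- move=> x x' m x'x /[dup] Fm [y yx' <-].
  by rewrite rb.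
- move=> x z zx; have [y] := neq [:: z]; rewrite inE => /eqP yz.
  exists y => //; rewrite rv /renv; case: eqVneq => // xz.
  by rewrite xz in zx.
- move=> m1 m2 z F1 F2; have [y] := neq [:: z]; rewrite inE => /eqP yz.
  by exists y => //; rewrite ra !FE.
- move=> x m z zm; have [y] := neq [:: z; x]; rewrite !inE negb_or => /andP[/eqP yz /eqP yx].
  exists y => //; have [->|/eqP zx] := eqVneq z x; first by rewrite rl2.
  case: zm => [//|zm]; rewrite rl ?FE//; exact: nesym.
Qed.

Lemma rec5 : sat_all o (Props5 V) -> exists g, ctor_morph o g.
Proof.
move=> /= [sv [sa [sl [sb_ [frv [fra [frl _]]]]]]]; apply: swap_rec.
do !split => //=.
move=> m1 m2 x1 x2 z zx1 zx2 zm1 zm2 e.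
by rewrite (sb_ x1 z)// (sb_ x2 z)// e.
Qed.

End Transfer.

Lemma rec4 (M : Type) (o : forall s, op_type V M s) :
  sat_all o (Props4 V) -> exists g, ctor_morph o g.
Proof.
move=> /= [sv [sa [sl [sf [fvv [fva [fvl _]]]]]]].
apply: (@rec5 _ (frops o (fun x m => ~ o fv m x))).
do !split => //=.
- move=> x x' m x'x x'm.
  have <- : o sw (o lm x m) x' x = o lm x m.
    by apply: sf => /fvl[/= a b]; [exact: x'm a|exact: b].
  by rewrite sl swapvR.
- by move=> x z zx /fvv.
- by move=> m1 m2 z z1 z2 /fva[].
- by move=> x m z zxm /fvl[/= a b]; case: zxm.
Qed.

Lemma rec2 (M : Type) (o : forall s, op_type V M s) :
  sat_all o (Props2 V) -> exists g, ctor_morph o g.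
Proof.
move=> /= [pv [pa [pl [pi [pc [pf [fvv [fva [fvl _]]]]]]]]].
apply: (@rec4 _ (swapops o (fun m x y => o pm m (transp x y)))).
do !split => //=.
move=> m x y xm ym; apply: pf; apply/seteqP; split=> // z [/= sz zm].
apply: sz; rewrite swapvN//; apply/eqP => e; by [apply: xm; rewrite -e|apply: ym; rewrite -e].
Qed.

Section Rec3.
Variables (M : Type) (o : forall s, op_type V M s).
Hypothesis H : sat_all o (Props3 V).

Let Sw := o sw.
Let FV := o fv.

Lemma fv3P m x : ~ FV m x <-> finite_set [set y | Sw m x y <> m].
Proof.
move: H => /= [_ [_ [_ [_ [_ [_ [fd _]]]]]]]; rewrite /FV fd /=.
by split=> [h|fin nfin]; [apply: contrapT h|exact: nfin].
Qed.

Lemma sw3fresh m x : ~ FV m x -> forall s : seq V, exists2 z, z \notin s & Sw m x z = m.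
Proof.
move=> /fv3P /finite_seqP[s' s'E] s.
have := freshP (s ++ s'); move: (fresh _) => z.
rewrite mem_cat negb_or => /andP[zs zs']; exists z => //.
apply: contrapT => zm; have : [set` s'] z by rewrite -s'E.
by apply/negP.
Qed.

Lemma sw3fv m x y : ~ FV m x -> ~ FV m y -> Sw m x y = m.
Proof.
have [_ [_ [_ [si [_ [sc _]]]]]] := H.
move=> xm /fv3P ym; have [->|xy] := eqVneq x y; first exact: si.
have /finite_seqP[s' s'E] := ym.
have [z] := sw3fresh xm [:: x, y & s'].
rewrite !inE !negb_or => /and3P[zx zy zs'] xz.
have yz : Sw m y z = m.
  apply: contrapT => zm; have : [set` s'] z by rewrite -s'E.
  by apply/negP.
have := sc m x z y z.
have xz' : x != z by rewrite eq_sym.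
by rewrite -/Sw xz yz swapvR swapvN// => <-.
Qed.

Lemma fv3sw m x z1 z2 : ~ FV m x -> ~ FV (Sw m z1 z2) (swapv z1 z2 x).
Proof.
have [_ [_ [_ [si [sv [sc _]]]]]] := H.
move=> /fv3P /finite_seqP[s sE]; apply/fv3P.
apply: (@sub_finite_set _ _ [set` map (swapv z1 z2) s]); last exact: finite_seq.
move=> y /= ny; rewrite -[y](swapvK z1 z2) mem_map; last exact: swapv_inj.
suff : [set y | Sw m x y <> m] (swapv z1 z2 y) by rewrite sE.
move=> /= e; apply: ny.
by have := sc m x (swapv z1 z2 y) z1 z2; rewrite -/Sw e swapvK => <-.
Qed.

Lemma rec3 : exists g, ctor_morph o g.
Proof.
have [sv [sa [sl [si [siv [sc [fd [fcb _]]]]]]]] := H.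
have fvlm x m : ~ FV (o lm x m) x.
  have [x0 x0P] := fcb.
  have := @fv3sw _ x0 x x0 (x0P (Sw m x x0)).
  by rewrite /Sw sl swapvR siv.
have fvvr x : FV (o vr x) `<=` [set x].
  move=> z; apply: contraPP => /= zx; apply/fv3P.
  apply: (@sub_finite_set _ _ [set` [:: x]]); last exact: finite_seq.
  move=> y /=; rewrite /Sw sv inE => yP; apply/eqP; apply: contrapT => yx; apply: yP.
  by rewrite swapvN//; apply/eqP => // /esym.
have fvap m1 m2 : FV (o ap m1 m2) `<=` FV m1 `|` FV m2.
  move=> z; apply: contraPP => /= /not_orP[/fv3P z1 /fv3P z2]; apply/fv3P.
  have : finite_set ([set y | Sw m1 z y <> m1] `|` [set y | Sw m2 z y <> m2]).
    by rewrite finite_setU.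
  apply: sub_finite_set => y /=; rewrite /Sw sa => yP.
  apply: contrapT => /not_orP[/contrapT e1 /contrapT e2].
  by apply: yP; rewrite e1 e2.
have fvlm' x m : FV (o lm x m) `<=` FV m `\ x.
  move=> z; apply: contraPP => /= zP.
  have [-> //|zx] := eqVneq z x.
  have /fv3P zm : ~ FV m z by move=> zm; apply: zP; split=> //; exact/eqP.
  apply/fv3P.
  have : finite_set ([set x] `|` [set y | Sw m z y <> m]).
    by rewrite finite_setU; split.
  apply: sub_finite_set => y /=; rewrite /Sw sl => yP.
  apply: contrapT => /not_orP[/eqP e1 /contrapT e2].
  by apply: yP; rewrite e2 swapvN// eq_sym.
apply: rec4.
exact: (conj sv (conj sa (conj sl (conj sw3fv (conj fvvr (conj fvap (conj fvlm' I))))))).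
Qed.
End Rec3.

Lemma rec1 (M : Type) (o : forall s, op_type V M s) :
  sat_all o (Props1 V) -> exists g, ctor_morph o g.
Proof.
move=> /= [pv [pa [pl [pi [pc [fd [fcb _]]]]]]].
apply: (@rec3 _ (swapops o (fun m x y => o pm m (transp x y)))).
do !split => //=.
- move=> m z; rewrite -[RHS]pi; congr (o pm m _); apply: perm_ext => x /=.
  by rewrite swapvv.
- move=> m x y; rewrite pc -[RHS]pi; congr (o pm m _); apply: perm_ext => z /=.
  by rewrite swapvK.
- move=> m x y z1 z2; rewrite !pc; congr (o pm m _); apply: perm_ext => z /=.
  exact/swapv_conj/swapv_inj.
Qed.

Definition initial_for (Ps : seq (property V)) : Prop :=
  forall (M : Type) (o : forall s, op_type V M s), sat_all o Ps ->
  exists g : Tr V -> M, forall s, s \in sig_of Ps -> op_morph g (std_op V s) (o s).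

Lemma init1 : initial_for (Props1 V).
Proof.
move=> M o H; have [g gP] := rec1 H; exists g; case: (gP) => g1 g2 g3.
have := H => /= -[pv [pa [pl [pi [pc [fd [fcb _]]]]]]].
have gpm : forall t (p : perm V), g (Perm_tm t p) = o pm (g t) p by apply: ctor_pm.
case=> //= _ t x.
rewrite fd /= => inf; rewrite FV_infinite /= => fin; apply: inf.
apply: sub_finite_set fin => y /= yP e; apply: yP.
by rewrite -gpm -/(Swap_tm _ _ _) e.
Qed.

Lemma init2 : initial_for (Props2 V).
Proof.
move=> M o H; have [g gP] := rec2 H; exists g; case: (gP) => g1 g2 g3.
have := H => /= -[pv [pa [pl [pi [pc [pf [fvv [fva [fvl _]]]]]]]]].
by case=> //= _; [exact: ctor_pm|exact: ctor_fv].
Qed.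

Lemma init3 : initial_for (Props3 V).
Proof.
move=> M o H; have [g gP] := rec3 H; exists g; case: (gP) => g1 g2 g3.
have := H => /= -[sv [sa [sl [si [siv [sc [fd [fcb _]]]]]]]].
have gsw : forall t x y, g (Swap_tm t x y) = o sw (g t) x y by apply: ctor_sw.
case=> //= _ t x.
rewrite fd /= => inf; rewrite FV_infinite /= => fin; apply: inf.
by apply: sub_finite_set fin => y /= yP e; apply: yP; rewrite -gsw e.
Qed.

Lemma init4 : initial_for (Props4 V).
Proof.
move=> M o H; have [g gP] := rec4 H; exists g; case: (gP) => g1 g2 g3.
have := H => /= -[sv [sa [sl [sf [fvv [fva [fvl _]]]]]]].
by case=> //= _; [exact: ctor_sw|exact: ctor_fv].
Qed.

Lemma init5 : initial_for (Props5 V).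
Proof.
move=> M o H; have [g gP] := rec5 H; exists g; case: (gP) => g1 g2 g3.
have := H => /= -[sv [sa [sl [sb_ [frv [fra [frl _]]]]]]].
case=> //= _; first exact: ctor_sw.
by move=> x t; exact: (ctor_fr (conj frv (conj fra (conj frl I))) gP).
Qed.

Lemma init6 : initial_for (Props6 V).
Proof.
move=> M o H; have [g gP] := rec6 H; exists g; case: (gP) => g1 g2 g3.
have := H => /= -[sv [sa [sl [sb_ [frv [fra [frl _]]]]]]].
case=> //= _; first exact: ctor_sw.
by move=> x t; exact: (ctor_fr (conj frv (conj fra (conj frl I))) gP).
Qed.

Lemma init7 : initial_for (Props7 V).
Proof.
move=> M o H; have [g gP] := rec7 H; exists g; case: (gP) => g1 g2 g3.
have := H => /= -[sv [sa [sl [sb_ [frv [fra [frl _]]]]]]].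
case=> //= _; first exact: ctor_sb.
by move=> x t; exact: (ctor_fr (conj frv (conj fra (conj frl I))) gP).
Qed.

Lemma init8 : initial_for (Props8 V).
Proof.
move=> M o H; have [g gP] := rec8 H; exists g; case: (gP) => g1 g2 g3.
have := H => /= -[rv [ra [rl _]]].
by case=> //= _; exact: ctor_ren.
Qed.

Lemma init9 : initial_for (Props9 V).
Proof.
move=> M o H; have [g gP] := rec9 H; exists g; case: (gP) => g1 g2 g3.
have := H => /= -[rv [ra [rl [rb [frv [fra [frl _]]]]]]].
case=> //= _; first exact: ctor_ren.
by move=> x t; exact: (ctor_fr (conj frv (conj fra (conj frl I))) gP).
Qed.

Lemma neqP x y : x <> y -> x != y. Proof. by move/eqP. Qed.

Lemma std_Sw : sat_all (std_op V)
  [:: SwVr V; SwAp V; SwLm V; SwId V; SwIv V; SwCp V; SwFv V; SwCg V; SwBvr V].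
Proof.
do !split => //=.
- by move=> x z1 z2; rewrite /Swap_tm Perm_Vr.
- by move=> m1 m2 z1 z2; rewrite /Swap_tm Perm_Ap.
- by move=> x m z1 z2; rewrite /Swap_tm Perm_Lm.
- by move=> m z; apply: Perm_fresh => x _ /=; rewrite swapvv.
- move=> m x y; rewrite /Swap_tm Perm_comp; apply: Perm_fresh => z _ /=.
  exact: swapvK.
- move=> m x y z1 z2; rewrite /Swap_tm !Perm_comp; congr Perm_tm.
  by apply: perm_ext => z /=; exact/swapv_conj/swapv_inj.
- by move=> m x y; exact: Swap_fresh.
- by move=> m1 m2 x1 x2 z _ _ z1 z2 e; rewrite (Lm_Swap _ z1) (Lm_Swap _ z2) e.
- by move=> x x' m _; exact: Lm_Swap.
Qed.

Lemma std_Pm : sat_all (std_op V)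
  [:: PmVr V; PmAp V; PmLm V; PmId V; PmCp V; PmFv V].
Proof.
do !split => //=.
- exact: Perm_Vr.
- exact: Perm_Ap.
- exact: Perm_Lm.
- exact: Perm_id.
- exact: Perm_comp.
- move=> m p e; apply: Perm_fresh => x xm; apply: contrapT => px.
  by have : set0 x by rewrite -e.
Qed.

Lemma std_Sb : sat_all (std_op V) [:: SbVr V; SbAp V; SbLm V; SbBvr V].
Proof.
do !split => //=.
- exact: Subst_Vr.
- exact: Subst_Ap.
- by move=> x m n z /neqP; exact: Subst_Lm.
- by move=> x x' m _; exact: Lm_Ren.
Qed.

Lemma std_Rn : sat_all (std_op V) [:: RnVr V; RnAp V; RnLm1 V; RnLm2 V;
  RnBvr V; RnBvr2 V; RnId V; RnIm V; RnCh V; RnCm V].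
Proof.
do !split => //=.
- exact: Ren_Vr.
- exact: Ren_Ap.
- by move=> x m y z /neqP ? /neqP; exact: Ren_Lm.
- by move=> x m z; apply: Ren_fresh; rewrite FV_Lm => -[_ /(_ erefl)].
- by move=> x x' m _; exact: Lm_Ren.
- by move=> x x' y m /neqP yx; apply: Lm_Ren; exact: FV_Ren.
- exact: Ren_id.
- by move=> m x1 x2 y /neqP xy; apply: Ren_fresh; exact: FV_Ren.
- by move=> m y x1 x2 x3 /neqP yx; apply: Ren_chain; exact: FV_Ren.
- by move=> m x1 x2 y1 y2 /neqP ? /neqP ? /neqP; exact: Ren_comm.
Qed.

Lemma std_Fr : sat_all (std_op V) [:: FrVr V; FrAp V; FrLm V].
Proof.
do !split => //=; rewrite /Fresh_tm.
- by move=> x z; rewrite FV_Vr.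
- by move=> m1 m2 z; rewrite FV_Ap => ? ? [].
- by move=> x m z; rewrite FV_Lm => zxm [/= a b]; case: zxm.
Qed.

Lemma std_Fv : sat_all (std_op V)
  [:: FvVr V; FvAp V; FvLm V; FvDPm V; FvDSw V; FCB V].
Proof.
split; first by move=> x; rewrite /= FV_Vr.
split; first by move=> m1 m2; rewrite /= FV_Ap.
split; first by move=> x m; rewrite /= FV_Lm.
split; first exact: FV_infinite.
split; first exact: FV_infinite.
by split=> //; exists (fresh [::]) => m; rewrite /= FV_Lm => -[_ /(_ erefl)].
Qed.

Ltac std_solve := rewrite /sat_all /=;
  have /= := std_Sw; have /= := std_Pm; have /= := std_Sb;
  have /= := std_Rn; have /= := std_Fr; have /= := std_Fv; tauto.

Lemma std1 : sat_all (std_op V) (Props1 V). Proof. std_solve. Qed.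
Lemma std2 : sat_all (std_op V) (Props2 V). Proof. std_solve. Qed.
Lemma std3 : sat_all (std_op V) (Props3 V). Proof. std_solve. Qed.
Lemma std4 : sat_all (std_op V) (Props4 V). Proof. std_solve. Qed.
Lemma std5 : sat_all (std_op V) (Props5 V). Proof. std_solve. Qed.
Lemma std6 : sat_all (std_op V) (Props6 V). Proof. std_solve. Qed.
Lemma std7 : sat_all (std_op V) (Props7 V). Proof. std_solve. Qed.
Lemma std8 : sat_all (std_op V) (Props8 V). Proof. std_solve. Qed.
Lemma std9 : sat_all (std_op V) (Props9 V). Proof. std_solve. Qed.

Definition default_op (M : Type) (m : M) : forall s, op_type V M s :=
  mkops (fun _ => m) (fun _ _ => m) (fun _ _ => m) (fun _ _ => m)
    (fun _ _ _ => m) (fun _ _ _ => m) (fun _ _ _ => m) (fun _ => set0)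
    (fun _ _ => True).

Definition total_op (S : signature) (M : model V S) (m : M) s : op_type V M s :=
  if @idP (s \in S) is ReflectT h then op M h else default_op m s.

Lemma total_opE (S : signature) (M : model V S) (m : M) s (h : s \in S) :
  op M h = total_op m s.
Proof.
rewrite /total_op; case: {-}_ / idP => [h'|//].
by rewrite (Prop_irrelevance h h').
Qed.

Section Recursor.
Variable Ps : seq (property V).
Hypothesis ctorPs : {subset sig_ctor <= sig_of Ps}.
Hypothesis stdPs : sat_all (std_op V) Ps.
Hypothesis initPs : initial_for Ps.

Definition TrP : pmodel Ps :=
  PModel (pmodel_model := TrM V (sig_of Ps)) (fun P h => (conj_allP _ _).2 stdPs P h).

Lemma TrP_init (C : pmodel Ps) : exists g : model_hom TrP C, True.
Proof.
pose m : C := op C (ctorPs (isT : vr \in sig_ctor)) (fresh [::]).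
have [|g gP] := initPs (o := total_op m).
  apply/conj_allP => P h; have := pmodelP C h; rewrite /satisfies.
  set o1 := (X in interp X -> _); set o2 := (X in _ -> interp X).
  suff -> : o1 = o2 by [].
  apply: functional_extensionality_dep => s.
  apply: functional_extensionality_dep => sP.
  exact: total_opE.
have gP' s (h : s \in sig_of Ps) : op_morph g (op TrP h) (op C h).
  by rewrite (total_opE m h); exact: gP.
by exists (ModelHom gP').
Qed.

Lemma TrP_uniq (C : pmodel Ps) (g h : model_hom TrP C) : g = h.
Proof.
apply: model_hom_ext; pose m : C := g (Vr (fresh [::])).
have cm (k : model_hom TrP C) : ctor_morph (total_op m) k.
  split=> [x|t1 t2|x t].
  - rewrite -(total_opE m (ctorPs (isT : vr \in sig_ctor))).
    exact: (mfunP k (ctorPs (isT : vr \in sig_ctor))).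
  - rewrite -(total_opE m (ctorPs (isT : ap \in sig_ctor))).
    exact: (mfunP k (ctorPs (isT : ap \in sig_ctor))).
  - rewrite -(total_opE m (ctorPs (isT : lm \in sig_ctor))).
    exact: (mfunP k (ctorPs (isT : lm \in sig_ctor))).
exact: ctor_morph_uniq (cm g) (cm h).
Qed.

Definition recursor :
    epi_recursor (B := model_cat V sig_ctor) (TrM V sig_ctor) :=
  @EpiRecursor (model_cat V sig_ctor) (TrM V sig_ctor) (pmodel_cat Ps) TrP
    (fun C => projT1 (cid (TrP_init C))) (fun C f => TrP_uniq _ _) (forget ctorPs)
    erefl.

End Recursor.

Lemma ctor1 : {subset sig_ctor <= sig_of (Props1 V)}. Proof. by case. Qed.
Lemma ctor2 : {subset sig_ctor <= sig_of (Props2 V)}. Proof. by case. Qed.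
Lemma ctor3 : {subset sig_ctor <= sig_of (Props3 V)}. Proof. by case. Qed.
Lemma ctor4 : {subset sig_ctor <= sig_of (Props4 V)}. Proof. by case. Qed.
Lemma ctor5 : {subset sig_ctor <= sig_of (Props5 V)}. Proof. by case. Qed.
Lemma ctor6 : {subset sig_ctor <= sig_of (Props6 V)}. Proof. by case. Qed.
Lemma ctor7 : {subset sig_ctor <= sig_of (Props7 V)}. Proof. by case. Qed.
Lemma ctor8 : {subset sig_ctor <= sig_of (Props8 V)}. Proof. by case. Qed.
Lemma ctor9 : {subset sig_ctor <= sig_of (Props9 V)}. Proof. by case. Qed.

Definition r1 := recursor ctor1 std1 init1.
Definition r2 := recursor ctor2 std2 init2.
Definition r3 := recursor ctor3 std3 init3.
Definition r4 := recursor ctor4 std4 init4.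
Definition r5 := recursor ctor5 std5 init5.
Definition r6 := recursor ctor6 std6 init6.
Definition r7 := recursor ctor7 std7 init7.
Definition r8 := recursor ctor8 std8 init8.
Definition r9 := recursor ctor9 std9 init9.

End Initiality.

(* Main.v *)
(* Each o(X) is the submodel of X generated by the constructors, the same for all nine
   recursors.  The only candidate for a definable morphism is the map g evaluating terms
   in X, and o(X) is its image, hence the quotient of the term model by the kernel of g.
   If g is definable by r_i, this kernel is a congruence for the operations (permutation,
   swapping, substitution, renaming) in the signature of r_i.  Conversely, all equations
   valid for terms descend to the quotient, so the quotient extends to a model for r_1,
   ..., r_6 when its kernel is a congruence for swapping, and to a model for r_8 and r_9
   when it is a congruence for renaming.  It remains that permutations of finite support
   are products of transpositions, that renaming is a case of substitution, and that a
   swapping is a composite of three renamings through a fresh variable. *)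
From mathcomp Require Import all_boot.
From mathcomp Require Import boolp classical_sets cardinality.
Require Import Defs.

Set Implicit Arguments.
Unset Strict Implicit.
Unset Printing Implicit Defensive.

Local Open Scope classical_set_scope.

(** * Swappings from renamings, permutations from transpositions *)

Lemma exists_fresh2 (V : varType) (t u : Tr V) (s : seq V) :
  exists z, [/\ ~ FV_tm t z, ~ FV_tm u z & z \notin s].
Proof.
have [st stP] := FV_seq t; have [su suP] := FV_seq u.
have := freshP (st ++ su ++ s); move: (fresh _) => z.
by rewrite !mem_cat !negb_or => /and3P[/stP ? /suP ? ?]; exists z.
Qed.

(** The free occurrences of [x] are parked at the fresh [z] while those of [y] become [x]. *)
Lemma Swap_Ren (V : varType) (t : Tr V) (x y z : V) :
  z != x -> z != y -> ~ FV_tm t z ->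
  Swap_tm t x y = Ren_tm (Ren_tm (Ren_tm t z x) x y) y z.
Proof.
move=> zx zy; elim/(@Tr_ind_fresh V [:: x; y; z]): t => [w|t1 t2 IH1 IH2|w t ws IH].
- rewrite FV_Vr /Swap_tm Perm_Vr !Ren_Vr /= /renv /swapv => /eqP zw; congr Vr.
  have [wx|wx] := eqVneq w x; first by rewrite (negbTE zy) eqxx.
  have [wy|wy] := eqVneq w y; first by rewrite eq_sym (negbTE zx).
  by rewrite eq_sym (negbTE zw).
- rewrite FV_Ap !Ren_Ap => /not_orP[n1 n2].
  by rewrite -IH1// -IH2// /Swap_tm Perm_Ap.
- move: ws; rewrite !inE !negb_or => /and3P[wx wy wz].
  rewrite FV_Lm /Swap_tm Perm_Lm !Ren_Lm// => n; rewrite -IH /= ?swapvN//.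
  by move=> ?; apply: n; split=> //= e; rewrite e eqxx in wz.
Qed.

(* A finitely supported permutation is a product of transpositions of variables
   in its support. *)
Lemma perm_transp_ind (V : varType) (A : set V) (P : perm V -> Prop) :
  P (perm_id V) ->
  (forall x y (p : perm V), A x -> A y -> P p -> P (perm_comp (transp x y) p)) ->
  forall p : perm V, supp p `<=` A -> P p.
Proof.
move=> P1 PM p; have /finite_seqP[s sE] := perm_supp p.
have : supp p `<=` [set` s] by rewrite sE.
elim: s p {sE} => [|x s IH] p ps pA.
  suff -> : p = perm_id V by [].
  by apply: perm_ext => x; apply: contrapT => /ps.
have [px|px] := pselect (p x = x).
  apply: IH => // y py; have := ps y py; rewrite /= inE => /orP[/eqP yx|//].
  by rewrite yx in py.
have Ax : A x by exact: pA.
have Apx : A (p x) by apply: pA => /permI.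
(* [q] fixes [x] and has no larger support than [p], so its support lies in [s]. *)
pose q := perm_comp (transp x (p x)) p.
have pE : p = perm_comp (transp x (p x)) q.
  by apply: perm_ext => y /=; rewrite swapvK.
have qx : q x = x by rewrite /q /= swapvR.
have qp : supp q `<=` supp p.
  move=> y qy py; apply: qy; rewrite /q /= py swapvN//.
    by apply/eqP => yx; apply: px; rewrite -yx.
  by apply/eqP => ypx; apply: px; apply: (@permI _ p); rewrite -ypx py.
rewrite pE; apply: PM => //; apply: IH; last exact: subset_trans pA.
move=> y qy; have := ps y (qp y qy); rewrite /= inE => /orP[/eqP yx|//].
by rewrite yx in qy.
Qed.

(** * The quotient of the terms by the kernel of [g] *)

Section QuotientOps.
Variables (V : varType) (M : Type) (g : Tr V -> M) (h : M -> Tr V).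
Hypothesis hK : cancel h g.

(* Freshness is made as large as possible, and FV is its complement: m has a fresh
   variable x as soon as x is fresh for one representative of m. *)
Definition quo_op : forall s, op_type V M s :=
  mkops (fun x => g (Vr x)) (fun m n => g (Ap (h m) (h n)))
    (fun x m => g (Lm x (h m))) (fun m p => g (Perm_tm (h m) p))
    (fun m x y => g (Swap_tm (h m) x y)) (fun m n x => g (Subst_tm (h m) (h n) x))
    (fun m y x => g (Ren_tm (h m) y x))
    (fun m => [set x | forall t, g t = m -> FV_tm t x])
    (fun x m => exists2 t, g t = m & Fresh_tm x t).

(** For an operation: the kernel of [g] is a congruence. For [fv] and [fr] it always holds. *)
Definition respects s := op_morph g (std_op V s) (quo_op s).

(** For an operation, [o] computes both sides in [X], where [t] and [h (g t)] have the same image;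
    then [i] is cancelled. *)
Lemma respects_factor (X : Type) (i : M -> X) s (o : op_type V X s) :
  injective i -> op_morph (i \o g) (std_op V s) o -> respects s.
Proof.
rewrite /respects => iI; case: s o => //= o oP; do ?by [move=> *; apply: iI; rewrite !oP /= !hK].
- by move=> t x; exact.
- by move=> x t xt; exists t.
Qed.

Lemma respects_pm_sw : respects pm -> respects sw.
Proof. by move=> gpm t x y; exact: gpm. Qed.

Lemma respects_sw_pm : respects sw -> respects pm.
Proof.
rewrite /respects /= => gsw t p.
have : g t = g (h (g t)) by rewrite hK.
move: (h (g t)) => u tu; apply: (@perm_transp_ind V setT (fun p => g (Perm_tm t p) = g (Perm_tm u p))) => //.
  by rewrite !Perm_id.
move=> x y {}p _ _ IH.
have E w : Perm_tm w (perm_comp (transp x y) p) = Swap_tm (Perm_tm w p) x y.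
  by rewrite /Swap_tm Perm_comp.
by rewrite !E gsw IH -gsw.
Qed.

Lemma respects_sb_ren : respects sb -> respects ren.
Proof. by rewrite /respects /= => gsb t y x; rewrite /Ren_tm gsb [RHS]gsb hK. Qed.

Lemma respects_ren_sw : respects ren -> respects sw.
Proof.
rewrite /respects /= => gren t x y.
(* As [z] is fresh for both terms, the same three renamings perform the swapping in both. *)
have [z [zt zu]] := exists_fresh2 t (h (g t)) [:: x; y].
rewrite !inE negb_or => /andP[zx zy].
have renE u y' x' : g (Ren_tm (h (g u)) y' x') = g (Ren_tm u y' x') by rewrite -gren.
rewrite !(Swap_Ren zx zy)// -renE -[RHS]renE; congr (g (Ren_tm (h _) _ _)).
by rewrite -renE -[RHS]renE; congr (g (Ren_tm (h _) _ _)); rewrite renE.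
Qed.

Lemma surj_ind (P : M -> Prop) : (forall t, P (g t)) -> forall m, P m.
Proof. by move=> Pg m; rewrite -(hK m). Qed.

Section Ctor.
Hypotheses (gap : respects ap) (glm : respects lm).

(** Computation on arbitrary representatives, by which equations between terms pass to the
    quotient. *)
Let apE t u : quo_op ap (g t) (g u) = g (Ap t u).
Proof. by rewrite gap. Qed.

Let lmE x t : quo_op lm x (g t) = g (Lm x t).
Proof. by rewrite glm. Qed.

Lemma quo_Fr : sat_all quo_op [:: FrVr V; FrAp V; FrLm V].
Proof.
split; [|split; [|split=> //]] => /=.
- by move=> x z zx; exists (Vr x) => //; rewrite /Fresh_tm FV_Vr.
- move=> _ _ z [t <- zt] [u <- zu]; exists (Ap t u); first by rewrite gap.
  by rewrite /Fresh_tm FV_Ap => -[].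
- move=> x m z [->|[t <- zt]].
    by exists (Lm x (h m)); rewrite // /Fresh_tm FV_Lm => -[_ /(_ erefl)].
  by exists (Lm x t); rewrite ?glm // /Fresh_tm FV_Lm => -[].
Qed.

Lemma quo_fvN m x : ~ quo_op fv m x <-> quo_op fr x m.
Proof.
split=> [/existsNP[t /not_implyP[tm tx]]|[t tm tx] /(_ t tm)//].
by exists t.
Qed.

Lemma quo_Fv : sat_all quo_op [:: FvVr V; FvAp V; FvLm V].
Proof.
have [frv [fra [frl _]]] := quo_Fr.
split; [|split; [|split=> //]].
- move=> x z; apply: contraPP => zx; apply/quo_fvN; exact: frv.
- move=> m n z; apply: contraPP => /not_orP[/quo_fvN zm /quo_fvN zn].
  apply/quo_fvN; exact: fra.
- move=> x m z; apply: contraPP => /not_andP nz; apply/quo_fvN; apply: frl.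
  by case: nz => [/quo_fvN|/contrapT]; [right|left].
Qed.

Lemma quo_FCB : interp (p := FCB V) (fun s _ => quo_op s).
Proof.
have [_ [_ [frl _]]] := quo_Fr.
(* Every variable works; [fresh [::]] merely names one. *)
by exists (fresh [::]) => m; apply/quo_fvN; apply: frl; left.
Qed.

Section Swap.
Hypothesis gsw : respects sw.

Let swE t x y : quo_op sw (g t) x y = g (Swap_tm t x y).
Proof. by rewrite gsw. Qed.

Let pmE t p : quo_op pm (g t) p = g (Perm_tm t p).
Proof. by rewrite (respects_sw_pm gsw). Qed.

(** The two variables may be fresh only for different representatives [t] and [u] of [m]. A third
    variable, fresh for both, splits the swapping into three, each of which fixes [t] or [u]. *)
Lemma quo_sw_fresh m x y : quo_op fr x m -> quo_op fr y m -> quo_op sw m x y = m.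
Proof.
move=> [t <- xt] [u tu yu].
have [z [zt zu]] := exists_fresh2 t u [:: x; y].
rewrite !inE negb_or => /andP[zx zy].
rewrite swE; have [->|xy] := eqVneq x y.
  by congr g; apply: Perm_fresh => a _ /=; rewrite swapvv.
(* (x y) = (x z) (y z) (x z), where x, z are fresh for t and y, z are fresh for u. *)
have -> : Swap_tm t x y = Swap_tm (Swap_tm (Swap_tm t x z) y z) x z.
  rewrite /Swap_tm !Perm_comp; congr Perm_tm; apply: perm_ext => a /=.
  have yx : y != x by rewrite eq_sym.
  have xz : x != z by rewrite eq_sym.
  have yz : y != z by rewrite eq_sym.
  have [->|ax] := eqVneq a x; first by rewrite !swapvL swapvR swapvN.
  have [->|ay] := eqVneq a y.
    by rewrite swapvR [swapv x z y]swapvN// swapvL swapvR.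
  have [->|az] := eqVneq a z; last by rewrite !swapvN.
  by rewrite swapvR [swapv x y z]swapvN// [swapv y z x]swapvN// swapvL.
rewrite -swE -[g (Swap_tm (Swap_tm t x z) y z)]swE -[g (Swap_tm t x z)]swE.
by rewrite swE (Swap_fresh xt zt) -tu swE (Swap_fresh yu zu) tu swE (Swap_fresh xt zt).
Qed.

(** If [x] is fresh for a representative [u], only the finitely many [y] free in [u] can change [m].
    Conversely, if almost all [y] leave [m] fixed, swapping [x] with such a variable fresh for [t]
    gives a representative without [x]. *)
Lemma quo_FvD m : quo_op fv m = [set x | infinite_set [set y | quo_op sw m x y <> m]].
Proof.
elim/surj_ind: m => t; apply/seteqP; split=> x /=; last first.
  move=> inf u ut; apply: contrapT => xu; apply: inf.
  apply: sub_finite_set (FV_finite u) => y /= yt.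
  by apply: contrapT => yu; apply: yt; apply: quo_sw_fresh; exists u.
move=> tx /finite_seqP[s sE].
have [z [zt _]] := exists_fresh2 t t (x :: s); rewrite inE negb_or => /andP[zx zs].
have xz : g (Swap_tm t x z) = g t.
  apply: contrapT => xz; have : [set y | g (Swap_tm (h (g t)) x y) <> g t] z.
    by rewrite -swE in xz.
  by rewrite sE /= (negbTE zs).
by have := tx _ xz; move/FV_Swap; rewrite swapvL.
Qed.

Lemma quo_Sw : sat_all quo_op
  [:: SwVr V; SwAp V; SwLm V; SwId V; SwIv V; SwCp V; SwFv V; SwCg V; SwBvr V].
Proof.
have [sv [sa [sl [si [siv [sc [_ [_ [sb _]]]]]]]]] := std_Sw V.
(* The bound variable is changed in a representative that has [x'] fresh; [SwBvr] and [SwCg] both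
   follow. *)
have frE x' x m : quo_op fr x' m -> quo_op lm x m = quo_op lm x' (quo_op sw m x' x).
  by move=> [t <- xt]; rewrite lmE swE lmE (Lm_Swap _ xt).
split; first by move=> x z1 z2; rewrite swE; congr g; exact: sv.
split.
  move=> m n z1 z2; rewrite -(hK m) -(hK n).
  by rewrite apE !swE apE; congr g; exact: sa.
split; first by move=> x m z1 z2; rewrite -(hK m) lmE !swE lmE; congr g; exact: sl.
split; first by move=> m z; rewrite -(hK m) swE; congr g; exact: si.
split; first by move=> m x y; rewrite -(hK m) !swE; congr g; exact: siv.
split; first by move=> m x y z1 z2; rewrite -(hK m) !swE; congr g; exact: sc.
split; first by move=> m x y xm ym; apply: quo_sw_fresh; exact/quo_fvN.
split; last by split=> //; move=> x x' m _; exact: frE.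
move=> m1 m2 x1 x2 z _ _ /frE e1 /frE e2 e; rewrite /= in e.
by rewrite (e1 x1) (e2 x2) /= e.
Qed.

Lemma quo_Pm : sat_all quo_op
  [:: PmVr V; PmAp V; PmLm V; PmId V; PmCp V; PmFv V; FvDPm V].
Proof.
have [pv [pa [pl [pi [pc _]]]]] := std_Pm V.
split; first by move=> x p; rewrite pmE; congr g; exact: pv.
split.
  move=> m n p; rewrite -(hK m) -(hK n).
  by rewrite apE !pmE apE; congr g; exact: pa.
split; first by move=> x m p; rewrite -(hK m) lmE !pmE lmE; congr g; exact: pl.
split; first by move=> m; rewrite -(hK m) pmE; congr g; exact: pi.
split; first by move=> m p q; rewrite -(hK m) !pmE; congr g; exact: pc.
split; last by split=> //; exact: quo_FvD.
(* [p] is a product of transpositions of variables fresh for [m], and each of them fixes [m]. *)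
move=> m p pm0; apply: (@perm_transp_ind V (~` quo_op fv m) (fun p => quo_op pm m p = m)).
- by elim/surj_ind: (m) => t; rewrite pmE Perm_id.
- move=> x y {pm0}p xm ym IH; rewrite -[RHS](quo_sw_fresh (x := x) (y := y)); [|exact/quo_fvN..].
  rewrite -[in RHS]IH; elim/surj_ind: (m) => t.
  by rewrite !pmE swE /Swap_tm Perm_comp.
- by move=> x px xm; have : set0 x by rewrite -pm0.
Qed.
End Swap.

Section Renaming.
Hypothesis gren : respects ren.

Let renE t y x : quo_op ren (g t) y x = g (Ren_tm t y x).
Proof. by rewrite gren. Qed.

(** All but [RnBvr] are equations with conditions on variables only; [RnBvr] is checked on a
    representative witnessing its freshness premise. *)
Lemma quo_Rn : sat_all quo_op [:: RnVr V; RnAp V; RnLm1 V; RnLm2 V;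
  RnBvr V; RnBvr2 V; RnId V; RnIm V; RnCh V; RnCm V].
Proof.
have [rv [ra [rl [rl2 [rb [rb2 [ri [rm [rc [rcm _]]]]]]]]]] := std_Rn V.
split; first by move=> x y z; rewrite renE; congr g; exact: rv.
split.
  move=> m n y z; rewrite -(hK m) -(hK n).
  by rewrite apE !renE apE; congr g; exact: ra.
split.
  by move=> x m y z *; rewrite -(hK m) lmE !renE lmE; congr g; exact: rl.
split; first by move=> x m z; rewrite -(hK m) lmE renE; congr g; exact: rl2.
split.
  by move=> x x' _ xx' [t <- xt]; rewrite lmE renE lmE; congr g; exact: rb.
split.
  by move=> x x' y m *; rewrite -(hK m) !renE !lmE; congr g; exact: rb2.
split; first by move=> m z; rewrite -(hK m) renE; congr g; exact: ri.
split; first by move=> m *; rewrite -(hK m) !renE; congr g; exact: rm.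
split; first by move=> m *; rewrite -(hK m) !renE; congr g; exact: rc.
by split=> //; move=> m *; rewrite -(hK m) !renE; congr g; exact: rcm.
Qed.
End Renaming.
End Ctor.
End QuotientOps.

(** * The submodel generated by the constructors *)

Section Segment.
Variables (V : varType) (X : model V sig_ctor).

(** Generated inductively rather than as an image, since o(X) must exist even when terms have no
    morphism to [X]. *)
Inductive reach : X -> Prop :=
| reach_vr (e : vr \in sig_ctor) x : reach (op X e x)
| reach_ap (e : ap \in sig_ctor) m n : reach m -> reach n -> reach (op X e m n)
| reach_lm (e : lm \in sig_ctor) x m : reach m -> reach (op X e x m).

Definition reach_op s : s \in sig_ctor -> op_type V {m | reach m} s :=
  match s with
  | vr => fun e x => exist _ _ (reach_vr e x)
  | ap => fun e m n => exist _ _ (reach_ap e (svalP m) (svalP n))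
  | lm => fun e x m => exist _ _ (reach_lm e x (svalP m))
  | pm | sw | sb | ren | fv | fr => fun e => False_rect _ (notF e)
  end.

Definition reach_model : model V sig_ctor := Model reach_op.

Lemma reach_valP s (e : s \in sig_ctor) :
  op_morph (@sval _ reach : reach_model -> X) (op reach_model e) (op X e).
Proof. by case: s e. Qed.

Definition reach_val : model_hom reach_model X := ModelHom reach_valP.

Variable g : model_hom (TrM V sig_ctor) X.

Lemma reach_hom t : reach (g t).
Proof.
elim/(@Tr_ind V): t => [x|t u rt ru|x t rt].
- by rewrite (mfunP g (isT : vr \in sig_ctor)); exact: reach_vr.
- by rewrite (mfunP g (isT : ap \in sig_ctor)); exact: reach_ap.
- by rewrite (mfunP g (isT : lm \in sig_ctor)); exact: reach_lm.
Qed.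

Lemma reach_surj (m : reach_model) : exists t, exist _ (g t) (reach_hom t) = m.
Proof.
case: m => m rm; suff [t tm] : exists t, g t = m by exists t; exact: eq_exist.
elim: rm => [e x|e _ _ _ [t <-] _ [u <-]|e x _ _ [t <-]].
- by exists (Vr x); exact: (mfunP g e).
- by exists (Ap t u); exact: (mfunP g e).
- by exists (Lm x t); exact: (mfunP g e).
Qed.

Definition corestrict (t : Tr V) : reach_model := exist _ (g t) (reach_hom t).

(** A section obtained by choice, to serve as [h] in the quotient construction. *)
Definition reach_sec (m : reach_model) : Tr V := sval (cid (reach_surj m)).

Lemma reach_secK : cancel reach_sec corestrict.
Proof. by move=> m; exact: svalP (cid (reach_surj m)). Qed.

Lemma reach_secE m : g (reach_sec m) = sval m.
Proof. by rewrite -[in RHS](reach_secK m). Qed.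

Lemma reach_respects s (o : op_type V X s) :
  op_morph g (std_op V s) o -> respects corestrict reach_sec s.
Proof.
apply: (respects_factor reach_secK (i := sval)).
by move=> [m rm] [n rn] /= mn; exact: eq_exist.
Qed.

Lemma reach_opE s (e : s \in sig_ctor) :
  op reach_model e = quo_op corestrict reach_sec s.
Proof.
case: s e => //= e.
- by apply/funext => x; apply: eq_exist; exact/esym/(mfunP g e).
- apply/funext => m; apply/funext => n; apply: eq_exist.
  by rewrite (mfunP g e) /= !reach_secE.
- apply/funext => x; apply/funext => m; apply: eq_exist.
  by rewrite (mfunP g e) /= reach_secE.
Qed.

Lemma corestrictP s (e : s \in sig_ctor) :
  op_morph corestrict (op (TrM V sig_ctor) e) (op reach_model e).
Proof. by rewrite reach_opE; exact: reach_respects (mfunP g e). Qed.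

Definition reach_mor : model_hom (TrM V sig_ctor) reach_model := ModelHom corestrictP.

End Segment.

Definition reach_segment (V : varType) : initial_segment (model_cat V sig_ctor) :=
  @InitialSegment (model_cat V sig_ctor) (fun=> True) (@reach_model V) (fun=> I)
    (@reach_val V).

(** * Definability by a recursor *)

Section Definability.
Variables (V : varType) (Ps : seq (property V)).
Hypothesis ctorPs : {subset sig_ctor <= sig_of Ps}.
Hypothesis stdPs : sat_all (std_op V) Ps.
Hypothesis initPs : initial_for Ps.
Let r := recursor ctorPs stdPs initPs.

(** The model witnessing definability has the carrier of [X], so its operations act on [X]. *)
Lemma definable_morph (X : model_cat V sig_ctor) g : definable r (X := X) g ->
  forall s, s \in sig_of Ps -> exists o, op_morph g (std_op V s) o.
Proof.
move=> [C [e gE]] s sPs; subst X; rewrite gE.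
by exists (op (C : pmodel Ps) sPs); exact: (mfunP (ini_mor C : model_hom (TrP stdPs) C) sPs).
Qed.

(** [g] and the initial morphism to the expansion of [X] by [o] both preserve the constructors,
    hence coincide. *)
Lemma definable_expansion (X : model_cat V sig_ctor) (o : forall s, op_type V X s) :
  (forall s (e : s \in sig_ctor), op X e = o s) -> sat_all o Ps ->
  forall g : @hom (model_cat V sig_ctor) (TrM V sig_ctor) X, definable r g.
Proof.
case: X o => M oX /= o oE oPs g.
(* This makes [X] the reduct of the expansion by computation, so that [erefl] serves as the equality
   of objects. *)
have XE : oX = fun s _ => o s.
  by apply: functional_extensionality_dep => s; apply: functional_extensionality_dep => e.
subst oX.
pose C := PModel (pmodel_model := Model (fun s _ => o s))
  (fun P (h : List.In P Ps) => (conj_allP _ _).2 oPs P h) : pmodel Ps.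
exists C, erefl; apply: model_hom_ext => /= t.
suff oP (f : model_hom (TrM V sig_ctor) (Model (fun s _ => o s))) : ctor_morph o f.
  apply: (@ctor_morph_uniq V M o); first exact: oP.
  exact: (oP (fmap (frg r) (ini_mor (C : ext r)))).
by split; [exact: (mfunP f (isT : vr \in sig_ctor))|exact: (mfunP f (isT : ap \in sig_ctor))|
  exact: (mfunP f (isT : lm \in sig_ctor))].
Qed.
End Definability.

(** [g] is the inclusion of o(X) after its corestriction, which is definable once the quotient
    structure satisfies [Ps']. *)
Lemma quasi_stronger_quo (V : varType) (Ps Ps' : seq (property V))
    (ctorPs : {subset sig_ctor <= sig_of Ps}) (stdPs : sat_all (std_op V) Ps)
    (initPs : initial_for Ps)
    (ctorPs' : {subset sig_ctor <= sig_of Ps'}) (stdPs' : sat_all (std_op V) Ps')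
    (initPs' : initial_for Ps') :
  (forall M (g : Tr V -> M) h, cancel h g ->
     (forall s, s \in sig_of Ps -> respects g h s) -> sat_all (quo_op g h) Ps') ->
  quasi_stronger (recursor ctorPs' stdPs' initPs') (recursor ctorPs stdPs initPs).
Proof.
move=> quoP; exists (reach_segment V) => X g gP; exists (reach_mor g); last exact: model_hom_ext.
apply: (definable_expansion _ _ _ (fun s e => reach_opE g e)).
apply: quoP; first exact: reach_secK.
by move=> s /(definable_morph gP)[o]; exact: reach_respects.
Qed.

(** * The comparisons of the nine recursors *)

Section QuotientModels.
Variables (V : varType) (M : Type) (g : Tr V -> M) (h : M -> Tr V).
Hypothesis hK : cancel h g.
Hypotheses (gap : respects g h ap) (glm : respects g h lm).

Lemma quo_swap_models : respects g h sw ->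
  sat_all (quo_op g h) (Props1 V) /\ sat_all (quo_op g h) (Props2 V) /\
  sat_all (quo_op g h) (Props3 V) /\ sat_all (quo_op g h) (Props4 V) /\
  sat_all (quo_op g h) (Props5 V) /\ sat_all (quo_op g h) (Props6 V).
Proof.
move=> gsw; have := quo_Sw hK gap glm gsw; have := quo_Pm hK gap glm gsw.
have := quo_Fr gap glm; have := quo_Fv gap glm; have := quo_FCB gap glm.
have FvDSwP : interp (p := FvDSw V) (fun s _ => quo_op g h s) by exact: quo_FvD hK gsw.
by rewrite /sat_all; cbn [conj_all Props1 Props2 Props3 Props4 Props5 Props6]; tauto.
Qed.

Lemma quo_ren_models : respects g h ren ->
  sat_all (quo_op g h) (Props8 V) /\ sat_all (quo_op g h) (Props9 V).
Proof.
move=> gren; have := quo_Rn hK gap glm gren; have := quo_Fr gap glm.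
by rewrite /sat_all; cbn [conj_all Props8 Props9]; tauto.
Qed.
End QuotientModels.

Theorem mainTheorem5 (V : varType) :
  quasi_equiv (r1 V) (r2 V) /\
  quasi_equiv (r2 V) (r3 V) /\
  quasi_equiv (r3 V) (r4 V) /\
  quasi_equiv (r4 V) (r5 V) /\
  quasi_equiv (r5 V) (r6 V) /\
  quasi_stronger (r6 V) (r8 V) /\
  quasi_equiv (r8 V) (r9 V) /\
  quasi_stronger (r9 V) (r7 V).
Proof.
do !split; apply: quasi_stronger_quo => M g h hK gP.
all: have [gap glm] := (gP ap isT, gP lm isT).
(* In the first eleven goals the stronger side is one of [r1] to [r6]; the weaker side provides
   [sw], [pm] or, for [r8], [ren]. *)
1-11: have gsw : respects g h sw by first
  [ exact: (gP sw isT) | exact: (respects_pm_sw (gP pm isT))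
  | exact: (respects_ren_sw (gP ren isT)) ].
1-11: by have := quo_swap_models hK gap glm gsw; tauto.
(* In the last three the stronger side is [r8] or [r9]; only [r7] provides [sb] instead of [ren]. *)
all: have gren : respects g h ren by first
  [ exact: (gP ren isT) | exact: (respects_sb_ren hK (gP sb isT)) ].
all: by have := quo_ren_models hK gap glm gren; tauto.
Qed.
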